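(* Let $G$ be a graph of order $n$. Then $\lambda^-(G)=0$ if and only if $G$ is one of the following graphs: 1. $K_n$; 2. $\overline{K_n}$; 3. a doubly extended bouquet-dipole graph; 4. a collection of one or more odd cycles that intersect in exactly one vertex; 5. a two-set perfectly orderable graph.
   Context: Graphs are finite, simple (no loops or multiple edges), undirected; $n=|V(G)|$ is the order of $G$ (at least 1). $K_n$ is the complete graph and $\overline{K_n}$ the edgeless graph on $n$ vertices. Skew zero forcing: a subset $S\subseteq V(G)$ (possibly empty) is colored blue and all other vertices white. Skew color change rule: if any vertex (blue or white) has exactly one white neighbor, then that white neighbor becomes blue. $S$ is a skew zero forcing set if repeated application of the rule eventually turns all vertices blue. The skew zero forcing span $\lambda^-(G)$ is the number of distinct cardinalities $k$ for which there exist $Z,F\subseteq V(G)$ with $|Z|=|F|=k$ such that $Z$ is a skew zero forcing set and $F$ is not a skew zero forcing set. A graph $G$ is a doubly extended bouquet-dipole if it consists of vertices $u$ and $v$ that are each on a nonempty set of odd cycles, where all other vertices on the cycles have degree two, and $u,v$ are joined by a path of even order that alternates between single even order paths whose internal vertices all have degree two, and multiple even order paths whose internal vertices all have degree two. (The order of a path is its number of vertices.) The paper's illustration: $u$ lies on a 5-cycle and two 3-cycles, $v$ lies on a 7-cycle; $u$ is joined to a vertex $a$ by a single path of order 4; $a$ is joined to a vertex $b$ by three internally disjoint paths, of orders 4, 6 and 4; and $b$ is joined to $v$ by a single path of order 4. A graph $G$ is two-set perfectly orderable if (1) $V(G)$ can be partitioned into ordered sets $U=\{u_1,\ldots,u_m\}$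 and $W=\{w_1,\ldots,w_m\}$ such that $u_i v\in E(G)$ only if $v=w_j$ for some $j\le i$, and (2) $u_iw_i\in E(G)$ for all $i\in\{1,\ldots,m\}$. In item 4, a collection consisting of a single odd cycle is just an odd cycle; with two or more cycles, all of them share one common vertex and are otherwise disjoint. *)

(* Defs.v *)
From mathcomp Require Import all_boot.

Set Implicit Arguments.
Unset Strict Implicit.
Unset Printing Implicit Defensive.

(* A finite simple graph is a finite vertex type T with a symmetric and
   irreflexive adjacency relation e : rel T. *)

Section SkewZeroForcing.
Variables (T : finType) (e : rel T).
Implicit Types S Z F : {set T}.

(* Blue vertices are those in S. *)
Definition white_neighbors S (v : T) : {set T} :=
  [set w | e v w & w \notin S].

Definition skew_step : rel {set T} := fun S S' =>
  [exists v, exists w, (white_neighbors S v == [set w]) && (S' == w |: S)].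

Definition skew_forcing S : bool := connect skew_step S [set: T].

Definition skew_span : nat :=
  #|[set k : 'I_#|T|.+1 |
      [exists Z : {set T}, exists F : {set T},
        [&& #|Z| == k, #|F| == k, skew_forcing Z & ~~ skew_forcing F]]]|.

End SkewZeroForcing.

Section GraphFamilies.
Variables (T : finType) (e : rel T).

Definition complete_graph : Prop := forall x y : T, x != y -> e x y.

Definition edgeless_graph : Prop := forall x y : T, ~~ e x y.

(* A walk is the sequence of its vertices; a closed walk repeats its first
   vertex at the end. *)
Definition consecutive (x y : T) (s : seq T) : bool :=
  infix [:: x; y] s || infix [:: y; x] s.

(* The vertices of the graph are those of vs, listed without repetition, and
   its edges are those traversed by the walks in ws. *)
Definition consists_of (vs : seq T) (ws : seq (seq T)) : Prop :=
  perm_eq vs (enum T) /\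
  forall x y : T, e x y = has (consecutive x y) ws.

(* The cycle through c, given by the list p of its other vertices, and the
   path from a to b, given by the list p of its internal vertices. *)
Definition cycle_walk (c : T) (p : seq T) : seq T := c :: rcons p c.
Definition path_walk (a b : T) (p : seq T) : seq T := a :: rcons p b.

Definition cycle_order (p : seq T) : nat := (size p).+1.
Definition path_order (p : seq T) : nat := (size p).+2.

(* A nonempty set of odd cycles through a common vertex, each given by the
   list of its other vertices. *)
Definition odd_cycles (C : seq (seq T)) : bool :=
  (0 < size C) && all (fun p => (3 <= cycle_order p) && odd (cycle_order p)) C.

Definition odd_bouquet : Prop :=
  exists (c : T) (C : seq (seq T)),
    odd_cycles C /\ consists_of (c :: flatten C) (map (cycle_walk c) C).

(* The vertices h 0 = u, h 1, ..., h r = v are the successive junctions of the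
   extended path, and P i lists the internal vertices of the paths joining h i
   to h i.+1: a single path for i even, at least two paths for i odd.
   - All these paths have even order, so the paths from u to v through all the
     junctions have even order exactly when r is odd; hence the alternation
     both starts and ends with a single path, possibly the same one (r = 1).
   - uniq (P i) prevents an edge, i.e., a path of order 2, from being counted
     twice.
   - The vertices other than the h i automatically have degree two, since every
     vertex is listed once and every edge lies on one of the walks. *)
Definition doubly_extended_bouquet_dipole : Prop :=
  exists (r : nat) (h : nat -> T) (P : nat -> seq (seq T))
         (Cu Cv : seq (seq T)),
    let u := h 0 in
    let v := h r in
    [/\ odd r,
        odd_cycles Cu,
        odd_cycles Cv,
        forall i, i < r ->
          [/\ if odd i then 2 <= size (P i) else size (P i) == 1,
              uniq (P i) &
              all (fun p => ~~ odd (path_order p)) (P i)] &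
        consists_of
          (mkseq h r.+1 ++ flatten Cu ++ flatten Cv
             ++ flatten [seq flatten (P i) | i <- iota 0 r])
          (map (cycle_walk u) Cu ++ map (cycle_walk v) Cv
             ++ flatten [seq map (path_walk (h i) (h i.+1)) (P i)
                        | i <- iota 0 r])].

Definition two_set_perfectly_orderable : Prop :=
  exists (m : nat) (u w : m.-tuple T),
    [/\ perm_eq (u ++ w) (enum T),
        forall (i : 'I_m) (x : T), e (tnth u i) x ->
          exists2 j : 'I_m, j <= i & x = tnth w j &
        forall i : 'I_m, e (tnth u i) (tnth w i)].

End GraphFamilies.

(* Main.v *)
(* Call a nonempty vertex set X a fort if no vertex has exactly one neighbor in X.
   A set is skew zero forcing iff it meets every fort, so the span vanishes iff
   there is a threshold t such that all t-sets are forts and no fort is smaller.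

   If there is no fort, the graph has a leaf u with neighbor w, and deleting both
   leaves a graph without forts; iterating this gives a two-set perfect ordering.
   If t = 1 the graph is edgeless. If 1 < t < n, put s = n - t + 1; then all degrees
   exceed s, and every set of at most s vertices lies in a neighborhood of size
   s + 1, which forces the graph to be complete.

   If t = n, the vertex set is the only fort. Split the graph into maximal threads
   (paths with interior vertices of degree two) between junctions. A thread of odd
   interior length would yield a proper fort, so a set of junctions extends to a
   vertex set that contains both or none of the neighbors of each interior vertex.
   Hence for every proper nonempty set X of junctions some junction starts exactly
   one thread ending in X. Applied to complements of singletons, this gives every
   junction v one neighboring junction [single v], joined to v by one thread, and
   one junction [multi v], joined to v by several, possibly v itself. Both maps are
   involutions, and [single \o multi] is transitive on the junctions, so that [multi]
   has a fixed point; from there single and multiple threads alternate up to a second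
   fixed point, which is a doubly extended bouquet-dipole. *)

Require Import Defs.
From mathcomp Require Import all_boot zify.

Set Implicit Arguments.
Unset Strict Implicit.
Unset Printing Implicit Defensive.

(** * Forts and the span *)


Lemma exists_subset_card (T : finType) (A : {set T}) k :
  k <= #|A| -> exists2 X : {set T}, X \subset A & #|X| = k.
Proof.
case/card_geqP=> s [us ss sA]; exists [set x in s].
  by apply/subsetP=> x; rewrite inE; apply: sA.
by rewrite cardsE -ss; apply/card_uniqP.
Qed.

Section Forts.
Variables (T : finType) (e : rel T).
Implicit Types (S X Y Z F : {set T}) (x y v w : T).

Definition nbrs v : {set T} := [set w | e v w].

(* The complement of a set of blue vertices at which the color change rule is stuck,
   when this complement is nonempty. *)
Definition fort X : bool :=
  (X != set0) && [forall v, #|nbrs v :&: X| != 1].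

Lemma fortP X :
  reflect (X != set0 /\ forall v w, nbrs v :&: X <> [set w]) (fort X).
Proof.
apply: (iffP andP) => -[X0 H]; split=> //.
  move=> v w E; move/forallP: H => /(_ v); by rewrite E cards1.
by apply/forallP=> v; apply/negP => /cards1P [w]; apply: H.
Qed.

Lemma fortPn X : X != set0 -> ~~ fort X -> exists v w, nbrs v :&: X = [set w].
Proof.
rewrite /fort => ->; rewrite negb_forall => /existsP [v]; rewrite negbK.
by case/cards1P=> w E; exists v, w.
Qed.

Lemma white_neighborsE S v : white_neighbors e S v = nbrs v :&: ~: S.
Proof. by apply/setP=> w; rewrite !inE. Qed.

Lemma skew_stepP S S' :
  reflect (exists v w, nbrs v :&: ~: S = [set w] /\ S' = w |: S)
          (skew_step e S S').
Proof.
apply: (iffP existsP) => [[v /existsP [w /andP [/eqP A /eqP B]]]|[v [w [A B]]]].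
  by exists v, w; rewrite -white_neighborsE.
by exists v; apply/existsP; exists w; rewrite white_neighborsE A B !eqxx.
Qed.

(** If [v] turns [w] blue while the fort [X] is entirely white, then [w \in X] would be the only
    neighbor of [v] in [X]; so no step enters such a fort. Conversely, a nonempty white set at which
    the rule is stuck is a fort. *)
Lemma skew_forcingP S :
  reflect (forall X, fort X -> X :&: S != set0) (skew_forcing e S).
Proof.
apply: (iffP idP) => [/connectP [p] | meets].
  elim: p S => [|S' p IH] S /=.
    by move=> _ <- X /andP [X0 _]; rewrite setIT.
  case/andP=> /skew_stepP [v [w [E ->]]] pth lst X fX.
  have := IH _ pth lst X fX; apply: contra => /eqP XS0.
  have wS : w \notin S by have/setP/(_ w) := E; rewrite !inE eqxx => /andP [].
  suff wX : w \notin X.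
    apply/eqP/setP=> z; have/setP/(_ z) := XS0; rewrite !inE => Ez.
    by have [->|_] := eqVneq z w; rewrite ?(negPf wX).
  apply/negP=> wX; case/fortP: fX => _ /(_ v w); case.
  apply/setP=> z; rewrite inE; have/setP/(_ z) := E; rewrite !inE => Ez.
  apply/andP/eqP => [[vz zX]|->].
    apply/eqP; rewrite -Ez vz /=; apply/negP=> zS.
    by have/setP/(_ z) := XS0; rewrite !inE zX zS.
  by split=> //; have/setP/(_ w) := E; rewrite !inE eqxx => /andP [].
have [n] := ubnP #|~: S|; elim: n => // n IH in S meets *.
rewrite ltnS => le_n.
have [->|SnT] := eqVneq S setT; first exact: connect0.
have CS0 : ~: S != set0 by apply: contra SnT => /eqP E; rewrite -(setCK S) E setC0.
have nf : ~~ fort (~: S).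
  by apply/negP => /meets; rewrite setIC setICr eqxx.
have [v [w E]] := fortPn CS0 nf.
have wS : w \notin S by have/setP/(_ w) := E; rewrite !inE eqxx => /andP [].
apply: (connect_trans (y := w |: S)).
  by apply: connect1; apply/skew_stepP; exists v, w.
apply: IH => [X fX|].
  apply: contra (meets X fX); rewrite setIUr => /eqP H.
  by rewrite -subset0 -H subsetUr.
apply: leq_trans le_n; apply: proper_card; apply/properP; split.
  by rewrite setCS subsetU1.
by exists w; rewrite !inE ?wS // eqxx.
Qed.

Lemma skew_span_eq0P :
  reflect (forall Z F, #|Z| = #|F| -> skew_forcing e Z -> skew_forcing e F)
          (skew_span e == 0).
Proof.
rewrite /skew_span cards_eq0.
apply: (iffP eqP) => [H Z F eqc fZ | H].
  have lt : #|Z| < #|T|.+1 by rewrite ltnS max_card.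
  apply: contraT => nF; have/setP/(_ (Ordinal lt)) := H.
  rewrite !inE => /negbT; rewrite negb_exists => /forallP /(_ Z).
  by rewrite negb_exists => /forallP /(_ F); rewrite -eqc eqxx fZ nF.
apply/setP=> k; rewrite !inE; apply/negbTE/negP => /existsP [Z /existsP [F]].
case/and4P => /eqP <- /eqP eqc fZ; apply/negP; rewrite negbK.
by apply: H fZ.
Qed.

(** A set is forcing exactly when its complement has fewer than [t] vertices: a larger complement
    contains a [t]-set, which is a fort, and a smaller one contains no fort. *)
Lemma skew_span0_threshold t :
    (forall X, fort X -> t <= #|X|) -> (forall X, #|X| = t -> fort X) ->
  skew_span e = 0.
Proof.
move=> lb ub; apply/eqP/skew_span_eq0P => Z F eqc fZ.
have lt : #|~: Z| < t.
  rewrite ltnNge; apply/negP => le_t.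
  have [X XZ cX] := exists_subset_card le_t.
  have/skew_forcingP/(_ X (ub X cX)) := fZ.
  by apply/negP; rewrite negbK setI_eq0 disjoints_subset.
apply/skew_forcingP => X fX; rewrite setI_eq0 disjoints_subset.
apply/negP => /subset_leq_card; have := lb X fX.
by have := cardsC Z; have := cardsC F; lia.
Qed.

(** The threshold is the order if the vertex set is a fort, and one more if there is no fort. *)
Lemma skew_span0_full : (forall X, fort X -> X = setT) -> skew_span e = 0.
Proof.
move=> fT; have [fTT|nfT] := boolP (fort setT).
  apply: (@skew_span0_threshold #|T|) => X.
    by move/fT->; rewrite cardsT.
  by move=> cX; rewrite (_ : X = setT) //; apply/eqP; rewrite eqEcard subsetT cardsT cX leqnn.
apply: (@skew_span0_threshold #|T|.+1) => X; last by have := max_card X; lia.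
by move=> fX; have XT := fT X fX; rewrite -XT fX in nfT.
Qed.

(** Take for [t] the size of a smallest fort [M]. The complement of [M] is not forcing, so no set of
    its size is; hence every [t]-set contains a fort, which fills it by minimality. *)
Lemma skew_span0_min_fort :
  skew_span e = 0 ->
  (forall X, ~~ fort X) \/
  exists2 t, 0 < t <= #|T| & forall X, (fort X -> t <= #|X|) /\ (#|X| = t -> fort X).
Proof.
move/eqP/skew_span_eq0P=> span0.
have [/existsP [X0 fX0]|] := boolP [exists X, fort X]; last first.
  by rewrite negb_exists => /forallP H; left.
right; case: (arg_minnP (fun X => #|X|) fX0) => M fM minM.
exists #|M|.
  by rewrite max_card card_gt0; case/fortP: fM => ->.
move=> X; split=> [|cX]; first exact: minM.
have nf : ~~ skew_forcing e (~: X).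
  apply/negP => fX; have H := span0 (~: X) (~: M) _ fX.
  have/skew_forcingP/(_ M fM): skew_forcing e (~: M).
    by apply: H; have := cardsC X; have := cardsC M; lia.
  by rewrite setICr eqxx.
have [/existsP [Y /andP [fY]]|/existsPn none] := boolP [exists Y, fort Y && (Y :&: ~: X == set0)].
  rewrite setI_eq0 disjoints_subset setCK => YX.
  suff -> : X = Y by [].
  by apply/eqP; rewrite eq_sym eqEcard YX cX minM.
case/negP: nf; apply/skew_forcingP => Y fY; have := none Y.
by rewrite fY.
Qed.

End Forts.

(** * Edgeless, complete and perfectly orderable graphs *)


Section SimpleFamilies.
Variables (T : finType) (e : rel T).
Hypotheses (e_sym : symmetric e) (e_irr : irreflexive e).
Implicit Types (S X Y Z F : {set T}) (x y v w : T).

Local Notation N := (nbrs e).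

Lemma in_nbrs v w : (w \in N v) = e v w.
Proof. by rewrite inE. Qed.

Lemma edgeless_span0 : edgeless_graph e -> skew_span e = 0.
Proof.
move=> E; have N0 v : N v = set0.
  by apply/setP=> w; rewrite !inE (negPf (E v w)).
apply: (@skew_span0_threshold _ e 1) => X.
  by case/fortP; rewrite card_gt0.
move=> cX; apply/fortP; rewrite -card_gt0 cX; split=> // v w.
by rewrite N0 set0I => /setP /(_ w); rewrite !inE eqxx.
Qed.

(** With at least two vertices the threshold is 3: [v] has [#|X| - (v \in X)] neighbors in [X],
    which is 1 for a vertex inside if [#|X| = 2] and for a vertex outside if [#|X| = 1]. *)
Lemma complete_span0 : complete_graph e -> skew_span e = 0.
Proof.
move=> K; have NE v : N v = ~: [set v].
  apply/setP=> w; rewrite !inE eq_sym; have [->|/K->//] := eqVneq v w.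
  by rewrite e_irr.
have [n1|n1] := leqP #|T| 1.
  apply: edgeless_span0 => x y.
  suff -> : x = y by rewrite e_irr.
  by apply/eqP; apply: contraTT n1 => xy; rewrite -ltnNge; apply/card_gt1P; exists x, y.
have cN v X : #|N v :&: X| = #|X| - (v \in X).
  by rewrite NE setIC -setDE; have := cardsD1 v X; lia.
apply: (@skew_span0_threshold _ e 3) => X; last first.
  move=> cX; rewrite /fort -card_gt0 cX; apply/forallP => v.
  by rewrite cN cX; case: (v \in X).
move=> /andP []; rewrite -card_gt0 => X0 /forallP H.
have /set0Pn [x xX] : X != set0 by rewrite -card_gt0.
have := H x; rewrite cN xX => H1.
have [cX|] := eqVneq #|X| 1; last by lia.
have /set0Pn [y yX] : ~: X != set0.
  by rewrite -card_gt0; have := cardsC X; lia.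
by have := H y; rewrite cN cX; move: yX; rewrite inE => /negPf ->.
Qed.

(** No [w j] lies in a fort, by increasing [j]: the other neighbors of [u j] are earlier vertices of
    [w]. Then no [u j] does, by decreasing [j]: the neighbors of [w j] in [u] have index at least
    [j]. *)
Lemma orderable_no_fort X : two_set_perfectly_orderable e -> ~~ fort e X.
Proof.
case=> m [u [w [perm low diag]]]; apply/negP => /fortP [X0 fX].
have uvm y : (exists i, y = tnth u i) \/ (exists i, y = tnth w i).
  have : y \in u ++ w by rewrite (perm_mem perm) mem_enum.
  by rewrite mem_cat => /orP [] /tnthP [i]; [left|right]; exists i.
have : uniq (u ++ w) by rewrite (perm_uniq perm) enum_uniq.
rewrite cat_uniq => /and3P [uu /hasPn dis uw].
have inj_w : injective (tnth w) by apply/tuple_uniqP.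
have noW j : tnth w j \notin X.
  have [n] := ubnP (j : nat); elim: n => // n IH in j *; rewrite ltnS => jn.
  apply/negP => wX; apply: (fX (tnth u j) (tnth w j)).
  apply/setP=> y; rewrite !inE; apply/andP/eqP => [[/low [i ij ->] iX]|->]; last by rewrite diag.
  move: ij; rewrite leq_eqVlt => /orP [/eqP/val_inj->//|ij].
  by move: iX; rewrite (negPf (IH i _)) // (leq_trans ij).
have noU j : tnth u j \notin X.
  have [n] := ubnP (m - j); elim: n => // n IH in j *; rewrite ltnS => jn.
  apply/negP => uX; apply: (fX (tnth w j) (tnth u j)).
  apply/setP=> y; rewrite !inE; apply/andP/eqP => [[ey yX]|->]; last by rewrite e_sym diag.
  case: (uvm y) => -[i yE]; last by move: yX; rewrite yE (negPf (noW i)).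
  move: ey; rewrite e_sym yE => /low [k ki /inj_w jk].
  move: ki; rewrite -jk leq_eqVlt => /orP [/eqP/val_inj->//|ji].
  by move: yX; rewrite yE (negPf (IH i _)) //; have := ltn_ord i; lia.
case/set0Pn: X0 => y yX; case: (uvm y) => -[i yE]; move: yX; rewrite yE.
  by rewrite (negPf (noU i)).
by rewrite (negPf (noW i)).
Qed.

(* A leaf u and its neighbor w can be split off: a fort X of the remaining graph
   gives the fort X or u |: X. *)
Lemma no_fort_pairing (D : {set T}) :
    (forall X, X != set0 -> X \subset D ->
       exists2 v, v \in D & #|N v :&: X| == 1) ->
  exists s : seq (T * T), [/\ perm_eq (unzip1 s ++ unzip2 s) (enum D),
    {in s, forall uw, e uw.1 uw.2} &
    forall a i, i < size s -> forall x, x \in D -> e (nth a s i).1 x ->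
      exists2 j, j <= i & x = (nth a s j).2].
Proof.
have [n] := ubnP #|D|; elim: n => // n IH in D *; rewrite ltnS => Dn nofort.
have [->|D0] := eqVneq D set0.
  by exists [::]; split=> //=; rewrite enum_set0.
have [u uD /cards1P [w Nu]] := nofort D D0 (subxx _).
have euw : e u w by have/setP/(_ w) := Nu; rewrite !inE eqxx => /andP [].
have wD : w \in D by have/setP/(_ w) := Nu; rewrite !inE eqxx => /andP [].
have onlyw x : x \in D -> e u x -> x = w.
  by move=> xD ux; have/setP/(_ x) := Nu; rewrite !inE xD ux => /esym/eqP.
have wu : w != u by apply: contraTneq euw => ->; rewrite e_irr.
pose D' := D :\ u :\ w.
have D'D : D' \subset D by rewrite /D'; apply: subset_trans (subD1set _ _) (subD1set _ _).
have [||s [perm edg low]] := IH D'.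
- by have := cardsD1 u D; have := cardsD1 w (D :\ u); rewrite !inE wu wD uD /D'; lia.
- move=> X X0 XD'.
  have XD : X \subset D by apply: subset_trans D'D.
  have uX : u \notin X by apply/negP => /(subsetP XD'); rewrite !inE eqxx andbF.
  have wX : w \notin X by apply/negP => /(subsetP XD'); rewrite !inE eqxx.
  have Nu0 : N u :&: X = set0.
    apply/setP=> x; rewrite !inE; apply/negbTE/negP => /andP [ux xX].
    by move: wX; rewrite -(onlyw x) ?xX ?(subsetP XD).
  (* The vertex [v] sought must avoid [w]. If [w] has exactly one neighbor in [X], it has two in
     [u |: X], so the latter set yields some [v != w]; such a [v] is not adjacent to [u], hence has
     one neighbor in [X] as well. *)
  have [w1|w1] := eqVneq #|N w :&: X| 1; last first.
    have [v vD v1] := nofort X X0 XD; exists v => //.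
    rewrite !inE vD andbT; apply/andP; split.
      by apply: contraNneq w1 => <-.
    by apply: contraTneq v1 => ->; rewrite Nu0 cards0.
  have [||v vD v1] := nofort (u |: X).
  - by apply/set0Pn; exists u; rewrite setU11.
  - by rewrite subUset sub1set uD.
  have Nv : v != w -> N v :&: (u |: X) = N v :&: X.
    move=> vw; apply/setP=> x; rewrite !inE; have [->|//] := eqVneq x u.
    rewrite (negPf uX) !andbF andbT e_sym.
    by apply/negbTE; apply: contra vw => /(onlyw _ vD) ->.
  have vw : v != w.
    apply: contraTneq v1 => ->; rewrite setIUr cardsU.
    have -> : N w :&: [set u] = [set u].
      by apply/setP=> x; rewrite !inE andbC; have [->|//] := eqVneq x u; rewrite e_sym euw.
    rewrite cards1 w1 (_ : _ :&: _ = set0) ?cards0 //.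
    by apply/setP=> x; rewrite !inE; have [->|//] := eqVneq x u; rewrite (negPf uX) andbF.
  rewrite Nv // in v1; exists v => //; rewrite !inE vD vw andbT /=.
  by apply: contraTneq v1 => ->; rewrite Nu0 cards0.
exists ((u, w) :: s); split=> /=.
- rewrite (perm_trans (y := u :: w :: (unzip1 s ++ unzip2 s))) //.
    by rewrite perm_cons -cat1s -[w :: (_ ++ _)]cat1s perm_catCA.
  apply: (perm_trans (y := u :: w :: enum D')); first by rewrite !perm_cons.
  apply: uniq_perm; rewrite /= ?enum_uniq ?inE ?mem_enum ?inE ?eqxx ?andbF ?orbF //.
    by rewrite eq_sym (negPf wu).
  move=> x; rewrite !inE !mem_enum !inE.
  have [->|_] := eqVneq x u; first by rewrite uD.
  by have [->|_] := eqVneq x w; rewrite ?wD.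
- by move=> p; rewrite inE => /orP [/eqP -> //|]; apply: edg.
(* A first component in [s] is not adjacent to [u], whose only neighbor in [D] is [w]; an edge to
   [w] is allowed by the new index 0. *)
move=> a [|i] /= lt x xD; first by move/(onlyw x xD) => ->; exists 0.
move=> ex; have [xu|xu] := eqVneq x u.
  have inD' : (nth a s i).1 \in D'.
    by rewrite -mem_enum -(perm_mem perm) mem_cat map_f // mem_nth.
  by move: ex; rewrite xu e_sym => /(onlyw _ (subsetP D'D _ inD')) E; move: inD'; rewrite E !inE eqxx.
have [->|xw] := eqVneq x w; first by exists 0.
have [|j ji ->] := low a i lt x _ ex; first by rewrite !inE xu xw.
by exists j.+1.
Qed.

Lemma no_fort_orderable : (forall X, ~~ fort e X) -> two_set_perfectly_orderable e.
Proof.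
move=> nofort; have [|s [perm edg low]] := @no_fort_pairing setT.
  move=> X X0 _; have [v [w E]] := fortPn X0 (nofort X).
  by exists v => //; rewrite E cards1.
have su : size (unzip1 s) == size s by rewrite size_map.
have sw : size (unzip2 s) == size s by rewrite size_map.
exists (size s), (Tuple su), (Tuple sw); split=> [|i x|i] /=.
- by rewrite (perm_trans perm) //; apply: uniq_perm (enum_uniq _) (enum_uniq _) _ => x; rewrite !mem_enum inE.
- have a := (x, x).
  rewrite (tnth_nth x) /= (nth_map a) // => ex.
  have [//|j ji ->] := low a i (ltn_ord i) x _ ex.
  have lt := leq_ltn_trans ji (ltn_ord i); exists (Ordinal lt) => //.
  by rewrite (tnth_nth x) /= (nth_map a).
have x := tnth (Tuple su) i; pose a := (x, x).
rewrite !(tnth_nth x) /= !(nth_map a) //.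
by apply: edg; rewrite mem_nth.
Qed.

End SimpleFamilies.

(** * Thresholds strictly between 1 and the order *)


Section IntermediateThreshold.
Variables (T : finType) (e : rel T) (s : nat).
Hypotheses (e_sym : symmetric e) (e_irr : irreflexive e).
Implicit Types (X Y : {set T}) (x y v w : T).

Local Notation N := (nbrs e).

Hypothesis s_gt1 : 1 < s.
Hypothesis cover :
  forall Y, #|Y| <= s -> exists2 v, #|N v| = s.+1 & Y \subset N v.

(** Suppose [p] and [r] are not adjacent. Then any other [q] in [N x] has only [x] and the rest of
    [N x] as neighbors, and one of [p], [r], say [p], has exactly one neighbor [z] outside
    [x |: N x]. Thus no vertex is adjacent to both [p] and [z], against [cover]. *)
Lemma covering_nbrs_near_clique x p r : #|N x| = s.+1 -> p \in N x -> r \in N x ->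
  p != r -> e p r.
Proof.
move=> Nx pA rA pr; apply: contraT => npr.
(* The set [x |: (N x :\ a :\ b)] has [s] elements. A vertex whose neighborhood covers it is a
   neighbor of [x] but not one of these elements, so it is [a] or [b]. *)
have pair a b : a \in N x -> b \in N x -> a != b ->
    exists2 w, w \in [set a; b] & #|N w| = s.+1 /\ N x :\ a :\ b \subset N w.
  move=> aA bA ab; have [|w cw] := cover (Y := x |: (N x :\ a :\ b)).
    rewrite cardsU1; have := cardsD1 a (N x); have := cardsD1 b (N x :\ a).
    by rewrite in_setD1 aA bA eq_sym ab Nx /=; case: (_ \notin _) => /=; lia.
  rewrite subUset sub1set => /andP [xw Aw]; exists w => //.
  have wA : w \in N x by rewrite inE e_sym; move: xw; rewrite inE.
  apply: contraT; rewrite !inE negb_or => /andP [wa wb].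
  have : w \in N w by apply: (subsetP Aw); rewrite in_setD1 wb in_setD1 wa.
  by rewrite inE e_irr.
wlog [cp Ap] : p r pA rA pr npr / #|N p| = s.+1 /\ N x :\ p :\ r \subset N p.
  move=> H; have [w] := pair p r pA rA pr.
  rewrite !inE => /orP [] /eqP -> [cw Aw].
    exact: (H p r).
  apply: (H r p) => //; rewrite 1?eq_sym 1?e_sym //; split=> //.
  by apply: subset_trans Aw; apply/subsetP=> z; rewrite !inE => /and3P [-> -> ->].
(* For the pairs [p, q] and [r, q] the vertex given by [pair] is [q] both times, since [p] or [r]
   would have to be adjacent to the other. *)
have full q : q \in N x -> q != p -> q != r -> N q = x |: (N x :\ q).
  move=> qA qp qr; have pq : p != q by rewrite eq_sym.
  have rq : r != q by rewrite eq_sym.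
  have [w + [cw A2]] := pair p q pA qA pq; have [w' + [cw' A1]] := pair r q rA qA rq.
  rewrite !inE => /orP [] /eqP E; rewrite {w'}E in cw' A1.
    have : p \in N r.
      by apply: (subsetP A1); rewrite !in_setD1 eq_sym qp pr.
    by rewrite inE e_sym (negPf npr).
  move=> /orP [] /eqP E; rewrite {w}E in cw A2.
    have : r \in N p.
      by apply: (subsetP A2); rewrite !in_setD1 eq_sym qr eq_sym pr.
    by rewrite inE (negPf npr).
  apply/esym/eqP; rewrite eqEcard cw; apply/andP; split.
    rewrite subUset sub1set inE e_sym; move: (qA); rewrite inE => -> /=.
    apply/subsetP=> z; rewrite in_setD1 => /andP [zq zA].
    have [zp|zp] := eqVneq z p; last first.
      by apply: (subsetP A2); rewrite !in_setD1 zq zp.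
    by apply: (subsetP A1); rewrite !in_setD1 zq zp pr.
  by rewrite cardsU1 !inE e_irr andbF /=; have := cardsD1 q (N x); rewrite qA Nx; lia.
(* [N p] has [s + 1] elements, one more than this set. *)
have [z zp zK] : exists2 z, z \in N p & z \notin x |: (N x :\ p :\ r).
  apply/exists_inP; rewrite -[X in is_true X]negbK negb_exists_in.
  apply/negP => /forall_inP H.
  have /subset_leq_card : N p \subset x |: (N x :\ p :\ r).
    by apply/subsetP=> z /H; rewrite negbK.
  rewrite cp cardsU1; have := cardsD1 p (N x); have := cardsD1 r (N x :\ p).
  by rewrite in_setD1 rA pA eq_sym pr Nx /=; case: (_ \notin _) => /=; lia.
have zNp : z != p by apply: contraTneq zp => ->; rewrite inE e_irr.
have zNr : z != r by apply: contraTneq zp => ->; rewrite inE (negPf npr).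
move: zK; rewrite !inE negb_or zNp zNr /= => /andP [zx zA].
have Npw w : w \in N p -> [|| w == x, w \in N x | w == z].
  move=> wp; apply: contraT; rewrite !negb_or => /and3P [wx wA wz].
  have /subset_leq_card : z |: (w |: (x |: (N x :\ p :\ r))) \subset N p.
    rewrite !subUset !sub1set zp wp Ap inE e_sym.
    by move: pA; rewrite inE => ->.
  rewrite cp !cardsU1; have := cardsD1 p (N x); have := cardsD1 r (N x :\ p).
  have zA' : z \in N x = false by rewrite inE (negPf zA).
  have xA' : x \in N x = false by rewrite inE e_irr.
  rewrite !in_setU1 !in_setD1 (negPf wA) rA pA Nx (negPf wx) zA' xA' !andbF.
  by rewrite (eq_sym z w) (negPf wz) (negPf zx) eq_sym pr => -> ->; rewrite !add1n ltnn.
have [|w cw] := cover (Y := [set p; z]).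
  by rewrite cards2; case: (p != z); lia.
rewrite subUset !sub1set => /andP [pw zw].
have wp : w \in N p by rewrite inE e_sym; move: pw; rewrite inE.
case/or3P: (Npw w wp) => [/eqP wx | wA | /eqP wz].
- by move: zw; rewrite wx inE (negPf zA).
- have wNp : w != p by apply: contraTneq wp => ->; rewrite inE e_irr.
  have wNr : w != r by apply: contraTneq wp => ->; rewrite inE (negPf npr).
  move: zw; rewrite (full w wA wNp wNr) !inE (negPf zx) (negPf zA).
  by rewrite andbF.
- by move: zw; rewrite wz inE e_irr.
Qed.


(** [x |: N x] is a clique on [s + 2] vertices. A further vertex [z] would have a common neighbor
    [w] with [x], of degree [s + 1]; but [w] is adjacent to [z] and to the other [s + 1] vertices of
    the clique. *)
Lemma covering_nbrs_complete : 0 < #|T| -> s.+2 = #|T|.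
Proof.
case/card_gt0P=> x0 _; have [|x Nx _] := cover (Y := set0); first by rewrite cards0.
pose K := x |: N x.
have cK : #|K| = s.+2 by rewrite cardsU1 Nx !inE e_irr.
apply/eqP; rewrite -cK eqn_leq max_card leqNgt; apply/negP => lt.
have /set0Pn [z] : ~: K != set0 by rewrite -card_gt0; have := cardsC K; lia.
rewrite !inE negb_or => /andP [zx zA].
have [|w Nw] := cover (Y := [set x; z]).
  by rewrite cards2; case: (x != z); lia.
rewrite subUset !sub1set !inE => /andP [wx wz].
have xw : e x w by rewrite e_sym.
have : z |: (K :\ w) \subset N w.
  rewrite subUset sub1set inE wz /=; apply/subsetP => y; rewrite !inE.
  case/andP=> yw /orP [/eqP->//|yA].
  by apply: (covering_nbrs_near_clique Nx); rewrite ?inE 1?eq_sym // -?(in_nbrs e).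
move/subset_leq_card; rewrite cardsU1 Nw !inE (negPf zx) (negPf zA) andbF.
by have := cardsD1 w K; rewrite cK !inE xw orbT /=; lia.
Qed.

End IntermediateThreshold.

Lemma fort_threshold_complete (T : finType) (e : rel T) t :
    symmetric e -> irreflexive e -> 1 < t < #|T| ->
    (forall X : {set T}, (fort e X -> t <= #|X|) /\ (#|X| = t -> fort e X)) ->
  complete_graph e.
Proof.
move=> e_sym e_irr /andP [t1 tn] fortX.
pose s := (#|T| - t).+1.
(* Otherwise [t - 1] vertices outside the neighborhood of [v] and one inside form a [t]-set that is
   not a fort; an isolated vertex would be a fort of size 1. *)
have deg v : s < #|nbrs e v|.
  rewrite ltnNge; apply/negP => le_s.
  have [N0|/set0Pn [w wN]] := eqVneq (nbrs e v) set0.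
    have /(proj1 (fortX _)) : fort e [set v].
      apply/fortP; split; first by apply/set0Pn; exists v; rewrite set11.
      move=> x w /setP E; have := E w; rewrite !inE eqxx => /andP [xw /eqP wv].
      have/setP/(_ x) := N0; rewrite !inE -wv e_sym xw.
      by [].
    by rewrite cards1; lia.
  have [|X XN cX] := @exists_subset_card T (~: nbrs e v) t.-1.
    by have := cardsC (nbrs e v); rewrite /s in le_s; lia.
  have wX : w \notin X by apply/negP => /(subsetP XN); rewrite inE wN.
  have /(proj2 (fortX _)) /fortP [_ /(_ v w)] : #|w |: X| = t by rewrite cardsU1 wX cX; lia.
  case; rewrite setIUr (_ : _ :&: X = set0) ?setU0; last first.
    by apply/eqP; rewrite setIC setI_eq0 disjoints_subset.
  by apply/setIidPr; rewrite sub1set.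
(* A set [X] of [t - 1] vertices outside [Y] is not a fort, so some [v] has exactly one neighbor in
   [X]. By the degree bound [v] is then adjacent to all [s] vertices outside [X]. *)
have cover (Y : {set T}) : #|Y| <= s -> exists2 v, #|nbrs e v| = s.+1 & Y \subset nbrs e v.
  move=> cY; have [|X XY cX] := @exists_subset_card T (~: Y) t.-1.
    by have := cardsC Y; rewrite /s in cY; lia.
  have X0 : X != set0 by rewrite -card_gt0 cX; lia.
  have nf : ~~ fort e X by apply/negP => /(proj1 (fortX _)); rewrite cX; lia.
  have [v [w E]] := fortPn X0 nf; exists v.
    have := cardsID X (nbrs e v); rewrite E cards1 => cN.
    have : #|nbrs e v :\: X| <= #|~: X| by apply/subset_leq_card; rewrite setDE subsetIr.
    have := cardsC X; have := deg v; rewrite /s; lia.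
  have YX : Y \subset ~: X by rewrite -[Y]setCK setCS.
  apply: (subset_trans YX).
  suff : ~: X \subset nbrs e v :\: X by move/subset_trans; apply; apply: subsetDl.
  suff /eqP <- : nbrs e v :\: X == ~: X by [].
  rewrite eqEcard setDE subsetIr -setDE /=.
  by have := cardsID X (nbrs e v); rewrite E cards1; have := deg v; have := cardsC X; rewrite /s; lia.
have s1 : 1 < s by rewrite /s; lia.
have Ts := covering_nbrs_complete e_sym e_irr s1 cover.
move=> x y xy; have := deg x; rewrite -ltnS Ts; last by lia.
move=> cN; suff : y \in nbrs e x by rewrite inE.
have/eqP -> : nbrs e x == ~: [set x].
  rewrite eqEcard; apply/andP; split; last by have := cardsC [set x]; rewrite cards1; lia.
  by apply/subsetP => z; rewrite !inE; apply: contraTneq => ->; rewrite e_irr.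
by rewrite !inE eq_sym.
Qed.

(** * Threads *)


Section Threads.
Variable T : finType.
Implicit Types (a b x y z v w : T) (p q : seq T).

(** An oriented thread: first end, interior vertices in order, last end. A single edge has an empty
    interior. *)
Definition thread : Type := (T * seq T * T)%type.
Implicit Types (d : thread) (W : seq thread).

Definition org d : T := d.1.1.
Definition mid d : seq T := d.1.2.
Definition dst d : T := d.2.
Definition flip d : thread := (dst d, rev (mid d), org d).
Definition hd d : T := head (dst d) (mid d).
Definition walk d : seq T := path_walk (org d) (dst d) (mid d).

Definition mids W : seq T := flatten (map mid W).
(** Both orientations of each thread, so a closed thread starts twice at its junction. *)
Definition darts W : seq thread := flatten [seq [:: d; flip d] | d <- W].

Lemma flipK : involutive flip.
Proof. by case=> [[a p] b]; rewrite /flip /org /mid /dst /= revK. Qed.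

Lemma walk_flip d : walk (flip d) = rev (walk d).
Proof.
by rewrite /walk /path_walk /= rev_cons rev_rcons -rcons_cons.
Qed.

Lemma dartsP W d : reflect (d \in W \/ flip d \in W) (d \in darts W).
Proof.
apply: (iffP flatten_mapP) => [[d' d'W]|].
  by rewrite !inE => /orP [] /eqP ->; [left | right; rewrite flipK].
by case=> dW; [exists d|exists (flip d)]; rewrite ?inE ?flipK ?eqxx ?orbT.
Qed.

Lemma flip_darts W d : (flip d \in darts W) = (d \in darts W).
Proof.
by apply/dartsP/dartsP; rewrite flipK => -[]; [right|left|right|left].
Qed.

Lemma perm_darts W1 W2 : perm_eq W1 W2 -> perm_eq (darts W1) (darts W2).
Proof. by move=> P; apply/perm_flatten/perm_map. Qed.

Lemma perm_mids W1 W2 : perm_eq W1 W2 -> perm_eq (mids W1) (mids W2).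
Proof. by move=> P; apply/perm_flatten/perm_map. Qed.

(** Holds after reordering the list and reversing some of its threads, and preserves threadings. *)
Definition same_threads W1 W2 :=
  [/\ size W1 = size W2, perm_eq (mids W1) (mids W2) & perm_eq (darts W1) (darts W2)].

Lemma darts_pick W d : d \in darts W -> exists W', same_threads W (d :: W').
Proof.
case/dartsP => dW.
  exists (rem d W); have P := perm_to_rem dW.
  by split; [rewrite (perm_size P) | apply: perm_mids | apply: perm_darts].
exists (rem (flip d) W); have P := perm_to_rem dW.
split; first by rewrite (perm_size P).
  apply: perm_trans (perm_mids P) _; rewrite /mids /= perm_cat2r.
  by rewrite perm_rev.
apply: perm_trans (perm_darts P) _; rewrite /darts /= flipK.
by apply/permP => a /=; rewrite addnCA.
Qed.

Variable e : rel T.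

(* Uniqueness of darts means that no thread is listed twice, in any orientation, and
   that no thread is its own reversal, i.e., an edge traversed back and forth. *)
Definition threading W : Prop :=
  [/\ {in darts W, forall d, org d \notin mids W},
      uniq (mids W),
      forall x y, e x y = has (fun d => infix [:: x; y] (walk d)) (darts W) &
      uniq (darts W)].

Lemma same_threading W1 W2 : same_threads W1 W2 -> threading W1 -> threading W2.
Proof.
case=> _ Pm Pd [ends um edges ud]; split.
- by move=> d; rewrite -(perm_mem Pd) -(perm_mem Pm); apply: ends.
- by rewrite -(perm_uniq Pm).
- by move=> x y; rewrite edges; apply: perm_has.
- by rewrite -(perm_uniq Pd).
Qed.

Section Threading.
Variable W : seq thread.
Hypothesis thW : threading W.

Lemma org_mids d : d \in darts W -> org d \notin mids W.
Proof. by case: thW => H _ _ _; apply: H. Qed.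

Lemma dst_mids d : d \in darts W -> dst d \notin mids W.
Proof. by rewrite -flip_darts => /org_mids. Qed.

Lemma mem_mids d x : d \in darts W -> x \in mid d -> x \in mids W.
Proof.
by case/dartsP => dW xd; apply/flatten_mapP; [exists d|exists (flip d)];
  rewrite ?mem_rev.
Qed.

Lemma midsP x : reflect (exists2 d, d \in darts W & x \in mid d) (x \in mids W).
Proof.
apply: (iffP idP) => [/flatten_mapP [d dW xd]|[d dW]]; last exact: mem_mids.
by exists d => //; apply/dartsP; left.
Qed.

Lemma uniq_mid d : d \in darts W -> uniq (mid d).
Proof.
case/darts_pick => W' /same_threading /(_ thW) [_].
by rewrite /mids /= cat_uniq => /and3P [].
Qed.

Lemma mid_inj d1 d2 x : d1 \in darts W -> d2 \in darts W ->
  x \in mid d1 -> x \in mid d2 -> d2 = d1 \/ d2 = flip d1.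
Proof.
move=> d1W; case/darts_pick: (d1W) => W' eqW.
have [_ + _ _] := same_threading eqW thW; case: eqW => _ _ Pd.
rewrite (perm_mem Pd) /mids /darts /= !inE cat_uniq => /and3P [_ /hasPn dis _].
case/or3P => [/eqP->|/eqP->|]; [by left|by right|].
move=> d2W x1 x2; have /dis : x \in mids W'.
  case/dartsP: d2W => dW; apply/flatten_mapP; first by exists d2.
  by exists (flip d2) => //; rewrite mem_rev.
by rewrite x1.
Qed.

Lemma flip_neq d : d \in darts W -> flip d != d.
Proof.
case/darts_pick => W' eqW; have [_ _ _ +] := same_threading eqW thW.
by rewrite /darts /= inE negb_or eq_sym => /andP [/andP [-> _] _].
Qed.

Lemma edge_darts d s1 s2 x y : d \in darts W -> walk d = s1 ++ x :: y :: s2 -> e x y.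
Proof.
move=> dW E; case: thW => _ _ -> _; apply/hasP; exists d => //.
by apply/infixP; exists s1, s2; rewrite E.
Qed.

Lemma edge_hd d : d \in darts W -> e (org d) (hd d).
Proof.
move=> dW; case E: (mid d) => [|x p].
  by apply: (@edge_darts d [::] [::]) => //; rewrite /walk /hd /path_walk E.
by apply: (@edge_darts d [::] (rcons p (dst d))) => //; rewrite /walk /hd /path_walk E.
Qed.

Lemma edge_org a y : a \notin mids W -> e a y ->
  exists d, [/\ d \in darts W, org d = a & hd d = y].
Proof.
move=> aB; case: (thW) => _ _ -> _ /hasP [d dW /infixP [s1 [s2 E]]].
exists d; case: s1 E => [|x s1]; rewrite /walk /path_walk /=.
  by case=> oa; rewrite /hd; case: (mid d) => [|z p] /= [-> _].
case=> _ E; case/negP: aB; apply: (mem_mids dW).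
move: E; case: (lastP s2) => [|s2' z].
  by rewrite -cat1s catA cats1 cats1 => /rcons_inj [-> _]; rewrite mem_rcons inE eqxx.
rewrite -!rcons_cons -rcons_cat => /rcons_inj [-> _].
by rewrite mem_cat !inE eqxx orbT.
Qed.

Lemma hd_mids d : d \in darts W -> (hd d \in mids W) = (mid d != [::]).
Proof.
move=> dW; case E: (mid d) => [|x p].
  by rewrite /hd E /=; apply/negbTE/dst_mids.
by apply: (mem_mids dW); rewrite /hd E mem_head.
Qed.

(** Darts leaving through a common interior vertex are equal or mutual reversals. In the second case
    this vertex is first and last in the interior, hence its only vertex, and the darts are equal
    too. *)
Lemma hd_inj d1 d2 : d1 \in darts W -> d2 \in darts W ->
  org d1 = org d2 -> hd d1 = hd d2 -> d1 = d2.
Proof.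
move=> d1W d2W eqo eqh; have := hd_mids d1W; rewrite eqh hd_mids //.
case: d1 d2 d1W d2W eqo eqh => [[a1 p1] b1] [[a2 p2] b2].
rewrite /org /hd /dst /mid /=; move=> d1W d2W eqa; rewrite -{a2}eqa in d2W *.
case: p1 p2 d1W d2W => [|x p1] [|x2 p2] //= d1W d2W; first by move=> ->.
move=> eqx _; rewrite -{x2}eqx in d2W *.
have [[-> ->] //|E] := mid_inj d1W d2W (mem_head x p1) (mem_head x p2).
move: E (uniq_mid d1W); rewrite /flip /org /dst /mid /= rev_cons => -[<- E1 ->].
case: (lastP p1) E1 => [|p z]; first by case=> ->.
by rewrite rev_rcons /= => -[-> _]; rewrite mem_rcons inE eqxx.
Qed.

(** An edge at [x] is traversed by [d] or its reversal, as interiors are disjoint. If the two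
    neighbors coincided, then an interior vertex would repeat or be an end, or [d] would be closed
    with one interior vertex and thus its own reversal. *)
Lemma edge_mid d p1 x p2 : d \in darts W -> mid d = p1 ++ x :: p2 ->
  (forall y, e x y = (y == last (org d) p1) || (y == head (dst d) p2)) /\
  last (org d) p1 != head (dst d) p2.
Proof.
move=> dW E; have xd : x \in mid d by rewrite E mem_cat mem_head orbT.
have um := uniq_mid dW; split.
  have next d' q1 q2 : d' \in darts W -> mid d' = q1 ++ x :: q2 -> e x (head (dst d') q2).
    move=> d'W E'; case: q2 E' => [|z q2] E' /=.
      by apply: (@edge_darts d' (org d' :: q1) [::]); rewrite /walk /path_walk ?E' //= rcons_cat.
    by apply: (@edge_darts d' (org d' :: q1) (rcons q2 (dst d'))); rewrite /walk /path_walk ?E' //= rcons_cat.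
  have Ef : mid (flip d) = rev p2 ++ x :: rev p1.
    by rewrite /mid /= E rev_cat rev_cons cat_rcons.
  have hdl : head (dst (flip d)) (rev p1) = last (org d) p1.
    by case: (lastP p1) => [|q z] //; rewrite rev_rcons last_rcons.
  move=> y; apply/idP/orP => [|[] /eqP ->]; first last.
  - exact: next E.
  - by rewrite -hdl; apply: next Ef; rewrite flip_darts.
  case: (thW) => _ _ -> _ /hasP [d' d'W /infixP [s1 [s2 E']]].
  have [q1 [q2 [E1 yE]]] : exists q1 q2, mid d' = q1 ++ x :: q2 /\ y = head (dst d') q2.
    case: s1 E' => [|z s1]; rewrite /walk /path_walk /=.
      by case=> ox _; have := org_mids d'W; rewrite ox (mem_mids dW xd).
    case=> _; case: (lastP s2) => [|s2' t].
      by rewrite -cat1s catA !cats1 => /rcons_inj [-> ->]; exists s1, [::]; rewrite cats1.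
    rewrite -!rcons_cons -rcons_cat => /rcons_inj [-> _].
    by exists s1, (y :: s2').
  have split_uniq r1 r2 r1' r2' : uniq (r1 ++ x :: r2) -> r1 ++ x :: r2 = r1' ++ x :: r2' -> r2 = r2'.
    move=> u E2; have := congr1 (drop (index x (r1 ++ x :: r2)).+1) E2.
    move: (u); rewrite {2}E2 in u *.
    have ind s t : uniq (s ++ x :: t) -> index x (s ++ x :: t) = size s.
      rewrite cat_uniq /= negb_or => /and3P [_ /andP [xs _] _].
      by rewrite index_cat (negPf xs) /= eqxx addn0.
    move=> u'; rewrite {1}ind // drop_cat ltnNge leqnSn /= subSnn /= drop0.
    rewrite E2 ind // drop_cat ltnNge leqnSn /= subSnn /= drop0.
    by [].
  have xd' : x \in mid d' by rewrite E1 mem_cat mem_head orbT.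
  have [Ed|Ed] := mid_inj dW d'W xd xd'; rewrite {}Ed in E1 yE.
    right; rewrite yE; apply/eqP; congr head.
    by apply/esym/(split_uniq p1 _ q1); rewrite -?E.
  left; rewrite yE -hdl; apply/eqP; congr head.
  by apply/esym/(split_uniq (rev p2) _ q1); rewrite -?Ef // rev_uniq.
have om := org_mids dW; have dm := dst_mids dW.
apply/negP => /eqP eqy; move: um; rewrite E cat_uniq => /and3P [_ /hasPn dis _].
case: (lastP p1) E eqy dis => [|q z] E /=.
  case: p2 E => [|z p2] E /= eqy _.
    have := flip_neq dW; case: d E eqy {xd om dm} dW => [[a p] b]; rewrite /flip /mid /dst /org /=.
    by move=> -> -> _; rewrite eqxx.
  by move: om; rewrite eqy (mem_mids dW) // E !inE eqxx orbT.
rewrite last_rcons => eqz; case: p2 E eqz => [|z' p2] E /= eqz dis.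
  by move: dm; rewrite -eqz (mem_mids dW) // E mem_cat mem_rcons mem_head.
by have := dis z; rewrite eqz !inE eqxx orbT mem_rcons mem_head => /(_ isT).
Qed.

End Threading.
End Threads.


(** * Joining threads at junctions that start only two darts *)

Section Merging.
Variable T : finType.
Implicit Types (a b x y z v w : T) (p q s : seq T) (d : thread T) (W : seq (thread T)).

Lemma uniq_darts W : uniq W -> {in W &, forall d1 d2, d1 != flip d2} -> uniq (darts W).
Proof.
elim: W => //= d W IH /andP [dW uW] H; rewrite /darts /= inE negb_or.
rewrite (H d d) ?mem_head //= IH // ?andbT => [|d1 d2 d1W d2W]; last first.
  by apply: H; rewrite inE ?d1W ?d2W orbT.
apply/andP; split; apply/negP => /dartsP; rewrite ?flipK => -[] inW.
- by rewrite inW in dW.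
- by have := H (flip d) d; rewrite !inE inW !eqxx orbT => /(_ isT isT).
- by have := H (flip d) d; rewrite !inE inW !eqxx orbT => /(_ isT isT).
- by rewrite inW in dW.
Qed.

Lemma infix2_cat x y s1 v s2 :
  infix [:: x; y] (s1 ++ v :: s2) =
  infix [:: x; y] (rcons s1 v) || infix [:: x; y] (v :: s2).
Proof.
elim: s1 => [|z s1 IH]; first by rewrite /= andbF.
rewrite rcons_cons !cat_cons !infix_consl IH orbA; congr (_ || _).
by case: s1 {IH} => [|z' s1]; rewrite ?rcons_cons ?cat_cons !prefix_cons !prefix0s.
Qed.

Lemma infix_walk_flip x y d :
  infix [:: x; y] (walk (flip d)) = infix [:: y; x] (walk d).
Proof. by rewrite walk_flip -infix_rev revK. Qed.

Variable e : rel T.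
Hypotheses (e_sym : symmetric e) (e_irr : irreflexive e).

Lemma threading_edges : exists W, threading e W.
Proof.
(* Every edge is a thread; comparing ranks lists it in one orientation only. *)
pose W := [seq (xy.1, [::], xy.2) : thread T
  | xy <- enum {: T * T} & e xy.1 xy.2 && (enum_rank xy.1 < enum_rank xy.2)].
have WP d : reflect (exists x y, [/\ d = (x, [::], y), e x y & enum_rank x < enum_rank y]) (d \in W).
  apply: (iffP mapP) => [[[x y]]|[x [y [-> exy ltxy]]]].
    by rewrite mem_filter => /andP [/andP [exy ltxy] _] ->; exists x, y.
  by exists (x, y); rewrite // mem_filter /= exy ltxy mem_enum.
have dartsWP d : reflect (exists x y, d = (x, [::], y) /\ e x y) (d \in darts W).
  apply: (iffP (dartsP _ _)) => [[] /WP [x [y []]]|[x [y [-> exy]]]].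
  - by move=> -> exy _; exists x, y.
  - by move/(congr1 (@flip T)); rewrite flipK => -> exy _; exists y, x; rewrite e_sym.
  have : enum_rank x != enum_rank y :> nat.
    by rewrite (inj_eq val_inj) (inj_eq enum_rank_inj); apply: contraTneq exy => ->; rewrite e_irr.
  rewrite neq_ltn => /orP [lt|lt]; [left|right]; apply/WP; first by exists x, y.
  by exists y, x; rewrite e_sym.
have midW : mids W = [::].
  suff : forall z, z \notin mids W by case: (mids W) => // z s /(_ z); rewrite mem_head.
  by move=> z; apply/negP => /flatten_mapP [d /WP [x [y [-> _ _]]]].
exists W; split; rewrite ?midW //.
  move=> x y.
  apply/idP/hasP => [exy|[d /dartsWP [a [b [-> eab]]]]].
    by exists (x, [::], y); [apply/dartsWP; exists x, y | rewrite /walk /path_walk infix_refl].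
  rewrite /walk /path_walk /= !andbF !orbF !andbT => /andP [/eqP -> /eqP ->].
  by [].
apply: uniq_darts.
  rewrite map_inj_in_uniq; first exact/filter_uniq/enum_uniq.
  by move=> [x y] [x' y'] _ _ [-> ->].
move=> d1 d2 /WP [x [y [-> _ lt]]] /WP [x' [y' [-> _ lt']]].
rewrite /flip /mid /org /dst /=; apply/eqP => -[xE yE].
by move: lt lt'; rewrite xE yE; lia.
Qed.

(** Meant for darts with a common origin, which becomes an interior vertex: back along [d1], then
    along [d2]. *)
Definition join d1 d2 : thread T := (dst d1, rev (mid d1) ++ org d1 :: mid d2, dst d2).

Lemma threading_join d1 d2 W :
    threading e (d1 :: d2 :: W) -> org d1 = org d2 ->
    {in darts W, forall d, org d != org d1} ->
    dst d1 != org d1 -> dst d2 != org d1 ->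
  threading e (join d1 d2 :: W).
Proof.
set v := org d1 => th ov oW dv1 dv2; have [ends um edges ud] := th.
pose D := [:: d1, flip d1, d2, flip d2 & darts W].
have DE : darts (d1 :: d2 :: W) = D by [].
rewrite DE in ends ud; have mE x : (x \in mids (join d1 d2 :: W)) = (x == v) || (x \in mids (d1 :: d2 :: W)).
  rewrite /mids /= !mem_cat !inE mem_rev.
  by case: (x \in mid d1); case: (x == v); case: (x \in mid d2).
have jE : darts (join d1 d2 :: W) = [:: join d1 d2, flip (join d1 d2) & darts W] by [].
have vm : v \notin mids (d1 :: d2 :: W) by apply: ends; rewrite /D mem_head.
have wj x y : infix [:: x; y] (walk (join d1 d2)) =
    infix [:: x; y] (walk (flip d1)) || infix [:: x; y] (walk d2).
  have -> : walk (join d1 d2) = (dst d1 :: rev (mid d1)) ++ v :: rcons (mid d2) (dst d2).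
    by rewrite /walk /path_walk /= rcons_cat.
  by rewrite infix2_cat {2}/walk -ov.
split.
- move=> d; rewrite jE mE !inE => /or3P [/eqP ->|/eqP ->|dW].
  + by rewrite negb_or dv1 (ends (flip d1)) // !inE eqxx ?orbT.
  + by rewrite negb_or dv2 (ends (flip d2)) // !inE eqxx ?orbT.
  + by rewrite negb_or oW // ends // !inE dW !orbT.
- rewrite /mids /= -catA cat_uniq rev_uniq /=.
  move: um vm; rewrite /mids /= cat_uniq !mem_cat !negb_or.
  case/and3P => -> dis -> /and3P [v1 v2 v3]; rewrite mem_rev v1 v2 v3 /= andbT.
  by apply: contra dis => /hasP [x xs]; rewrite mem_rev => xm; apply/hasP; exists x.
- have hc (a : pred (thread T)) d (s : seq (thread T)) : has a (d :: s) = a d || has a s by [].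
  move=> x y; rewrite edges DE jE /D !hc; cbv beta.
  rewrite wj (infix_walk_flip _ _ (join d1 d2)) wj !infix_walk_flip.
  move: (has _ (darts W)) (infix [:: x; y] (walk d1)) (infix [:: y; x] (walk d1)).
  by move: (infix [:: x; y] (walk d2)) (infix [:: y; x] (walk d2)) => [] [] [] [] [].
have jW : join d1 d2 \notin darts W.
  apply/negP => jW; case/negP: vm; rewrite /mids /= mem_cat mem_cat; apply/or3P/Or33.
  case/dartsP: jW => jW; apply/flatten_mapP; first by exists (join d1 d2); rewrite ?mem_cat ?mem_head ?orbT.
  by exists (flip (join d1 d2)); rewrite ?mem_rev ?mem_cat ?mem_head ?orbT.
rewrite jE /= inE negb_or jW flip_darts jW andbT /=.
apply/andP; split; last first.
  by move: ud; rewrite /D /= => /and5P [].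
(* If the joined thread is its own reversal, the only occurrence of [v] is in its middle, so [d1]
   and [d2] have the same interior and the same ends and are equal. *)
apply/eqP; rewrite /flip /join /mid /dst /org /=.
case=> eqd; rewrite rev_cat rev_cons revK cat_rcons => E _.
have u1 : uniq (mid d1) by apply: (uniq_mid th); rewrite DE mem_head.
have u2 : uniq (mid d2) by apply: (uniq_mid th); rewrite DE !inE eqxx !orbT.
have v1 : v \notin mid d1 by move: vm; rewrite /mids /= mem_cat negb_or => /andP [].
have v2 : v \notin mid d2 by move: vm; rewrite /mids /= !mem_cat !negb_or => /and3P [].
have sz : size (rev (mid d1)) = size (rev (mid d2)).
  have := congr1 (index v) E; rewrite !index_cat !mem_rev (negPf v1) (negPf v2) /= eqxx !addn0.
  by [].
move/eqP: E; rewrite eqseq_cat // => /andP [/eqP Er _].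
have Em : mid d1 = mid d2 by rewrite -[LHS]revK Er revK.
move: ud; rewrite /D (_ : d2 = d1) /= ?inE ?eqxx ?orbT //.
by case: (d1) (d2) (ov : org d1 = org d2) eqd Em => [[a p] b] [[a' p'] b']; rewrite /org /dst /mid /= => -> -> ->.
Qed.

(* If only two darts start at a junction, they are the two orientations of a closed
   thread: otherwise the junction could be absorbed by joining its two threads. *)
Definition reduced W : bool :=
  all (fun d1 => all (fun d2 =>
    [&& org d1 == org d2, d1 != d2 &
        all (fun d => (org d == org d1) ==> (d == d1) || (d == d2)) (darts W)]
    ==> (d2 == flip d1)) (darts W)) (darts W).

(** Starting from single edges, any violation of [reduced] allows two threads to be joined, which
    shortens the list. *)
Lemma threading_reduced : exists W, threading e W /\ reduced W.
Proof.
have [W] := threading_edges; have [n] := ubnP (size W).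
elim: n => // n IH in W *; rewrite ltnS => sW thW.
have [redW|] := boolP (reduced W); first by exists W.
case/allPn => d1 d1W /allPn [d2 d2W]; rewrite negb_imply.
case/andP=> /and3P [/eqP ov d12 /allP only] fd.
have [W1 eq1] := darts_pick d1W; have th1 := same_threading eq1 thW.
have [s1 _ P1] := eq1.
have d2W1 : d2 \in darts W1.
  by move: d2W; rewrite (perm_mem P1) !inE eq_sym (negPf d12) (negPf fd).
have [W2 [s2 Pm2 P2]] := darts_pick d2W1.
have th2 : threading e (d1 :: d2 :: W2).
  apply: same_threading th1; split; first by rewrite /= s2.
    by rewrite /mids /= perm_cat2l.
  by rewrite /darts /= !perm_cons.
have PD : perm_eq (darts W) [:: d1, flip d1, d2, flip d2 & darts W2].
  by apply: perm_trans P1 _; rewrite /darts /= !perm_cons.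
have u : uniq [:: d1, flip d1, d2, flip d2 & darts W2] by rewrite -(perm_uniq PD); case: thW.
have onlyv d : d \in darts W -> org d = org d1 -> d = d1 \/ d = d2.
  by move=> dW od; have := only d dW; rewrite od eqxx => /orP [] /eqP ->; [left|right].
apply: (IH (join d1 d2 :: W2)); first by move: s1 s2 sW; rewrite /=; lia.
apply: threading_join => //.
- move=> d dW2; apply/eqP => od.
  have dW : d \in darts W by rewrite (perm_mem PD) !inE dW2 !orbT.
  by move: u; case: (onlyv d dW od) => <-; rewrite /= !inE dW2 !orbT ?andbF.
(* If [d1] ended at its origin, [flip d1] would also start there and be [d1] or [d2], against the
   uniqueness of darts. *)
- apply/eqP => od.
  have fW : flip d1 \in darts W by rewrite flip_darts.
  case: (onlyv _ fW od) => E; move: u; rewrite /= E !inE eqxx ?orbT ?andbF //.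
- apply/eqP => od.
  have fW : flip d2 \in darts W by rewrite flip_darts.
  case: (onlyv _ fW od) => E; move: u; rewrite /= E !inE eqxx ?orbT ?andbF //.
Qed.

End Merging.


(** * Forts along threads and the parity of thread interiors *)

Section Classes.
Variables (T : finType) (e : rel T).
Implicit Types (a b x y z v w : T) (p q s : seq T) (d : thread T) (X : {set T}).
Variable W : seq (thread T).
Hypothesis thW : threading e W.

Lemma index_split p1 x p2 : uniq (p1 ++ x :: p2) -> index x (p1 ++ x :: p2) = size p1.
Proof.
rewrite cat_uniq /= negb_or => /and3P [_ /andP [xs _] _].
by rewrite index_cat (negPf xs) /= eqxx addn0.
Qed.

Lemma index_rev p x : uniq p -> x \in p -> index x (rev p) = size p - (index x p).+1.
Proof.
move=> up /splitPr xp; case: xp up => p1 p2 up.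
rewrite index_split // rev_cat rev_cons cat_rcons index_split ?size_rev ?size_cat /=; first lia.
by rewrite -cat_rcons -rev_cons -rev_cat rev_uniq.
Qed.

(** The neighbors of an interior vertex are its two neighbors on the thread, and those of a junction
    are the [hd] of its darts. The two conditions thus exclude exactly one neighbor in [X] at either
    kind of vertex. *)
Lemma fort_threading X :
    X != set0 ->
    (forall d p1 x p2, d \in darts W -> mid d = p1 ++ x :: p2 ->
       (last (org d) p1 \in X) = (head (dst d) p2 \in X)) ->
    (forall d, d \in darts W -> hd d \in X ->
       exists d', [/\ d' \in darts W, d' != d, org d' = org d & hd d' \in X]) ->
  fort e X.
Proof.
move=> X0 inner ends; apply/fortP; split=> // v w /setP E.
have := E w; rewrite !inE eqxx => /andP [vw wX].
have [vm|vB] := boolP (v \in mids W).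
  case/(midsP W): vm => d dW /splitPr vd; case eqm : _ / vd => [p1 p2].
  have [Nv neq] := edge_mid thW dW eqm.
  have inX := inner d p1 v p2 dW eqm.
  have wlh : (w == last (org d) p1) || (w == head (dst d) p2) by rewrite -Nv.
  have lX : last (org d) p1 \in X by case/orP: wlh => /eqP wE; [rewrite -wE | rewrite inX -wE].
  have := E (last (org d) p1); have := E (head (dst d) p2).
  rewrite !inE !Nv !eqxx orbT -inX lX /= => /esym/eqP hw /esym/eqP lw.
  by rewrite hw lw eqxx in neq.
have [d [dW od hdw]] := edge_org thW vB vw.
have [||d' [d'W neq od' hdX]] := ends d => //; first by rewrite hdw.
have := E (hd d'); rewrite !inE hdX -od -od' (edge_hd thW) //= => /esym/eqP hw.
by case/eqP: neq; apply: (hd_inj thW) => //; rewrite hw.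
Qed.

(* For a thread of odd interior length, this set (if the thread is closed) or its
   complement (if the ends differ) is a proper fort. *)
Definition even_set d : {set T} := [set x in mid d | ~~ odd (index x (mid d))].

Lemma even_set_flip d : d \in darts W -> odd (size (mid d)) ->
  even_set (flip d) = even_set d.
Proof.
move=> dW od; apply/setP=> x; rewrite !inE mem_rev.
case: (boolP (x \in mid d)) => //= xd; have := xd; rewrite -index_mem => lt.
rewrite index_rev ?(uniq_mid thW) //; congr (~~ _).
by rewrite oddB // od /= negbK.
Qed.

(** The vertex before [x] has position [size p1 - 1], and ends of the thread are not in the set.
    With [even_set_head], an interior vertex of a thread of odd interior length has both or none of
    its neighbors in the set. *)
Lemma even_set_last d p1 x p2 : d \in darts W -> mid d = p1 ++ x :: p2 ->
  (last (org d) p1 \in even_set d) = odd (size p1).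
Proof.
move=> dW E; have um := uniq_mid thW dW.
case: (lastP p1) E => [|q z] E /=.
  rewrite inE; apply/negbTE; rewrite negb_and.
  by have := org_mids thW dW; apply: contraNT; rewrite negb_or negbK => /andP [/(mem_mids dW)].
rewrite last_rcons size_rcons /= inE E mem_cat mem_rcons mem_head /=; congr (~~ odd _).
by move: um; rewrite E cat_rcons => um; rewrite index_split.
Qed.

Lemma even_set_head d p1 x p2 : d \in darts W -> odd (size (mid d)) -> mid d = p1 ++ x :: p2 ->
  (head (dst d) p2 \in even_set d) = odd (size p1).
Proof.
move=> dW od E; have um := uniq_mid thW dW.
case: p2 E => [|z q] E /=.
  rewrite inE; move: od; rewrite E size_cat addn1 /= => /negPf ->.
  apply/negbTE; rewrite negb_and -E.
  by have := dst_mids thW dW; apply: contraNT; rewrite negb_or negbK => /andP [/(mem_mids dW)].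
rewrite inE E mem_cat !inE eqxx !orbT /= -cat_rcons index_split ?size_rcons /= ?negbK //.
by rewrite cat_rcons -E.
Qed.

Hypothesis redW : reduced W.

Lemma reducedP d1 d2 : d1 \in darts W -> d2 \in darts W -> org d1 = org d2 -> d1 != d2 ->
    {in darts W, forall d, org d = org d1 -> d = d1 \/ d = d2} ->
  d2 = flip d1.
Proof.
move=> d1W d2W od neq only; apply/eqP.
have /allP/(_ d1 d1W)/allP/(_ d2 d2W)/implyP := redW; apply.
rewrite od eqxx neq /=; apply/allP => d dW; apply/implyP => /eqP od'.
by case: (only d dW); rewrite ?od // => ->; rewrite eqxx ?orbT.
Qed.

Hypothesis fortT : fort e setT.
Hypothesis only_setT : forall X, fort e X -> X = setT.

(** As the vertex set is a fort, no vertex has degree one. *)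
Lemma another_dart d : d \in darts W ->
  exists d', [/\ d' \in darts W, d' != d & org d' = org d].
Proof.
move=> dW; case/fortP: fortT => _ /(_ (org d) (hd d)) H.
have [/existsP [d' /andP [h1 h2]]|] := boolP [exists y, e (org d) y && (y != hd d)].
  have [d2 [d2W o2 hd2]] := edge_org thW (org_mids thW dW) h1.
  by exists d2; split=> //; apply: contraNneq h2 => <-; rewrite hd2.
rewrite negb_exists => /forallP K; case: H; apply/setP=> y.
rewrite !inE andbT; have := K y; have [->|_] := eqVneq y (hd d); first by rewrite (edge_hd thW).
by rewrite andbT => /negPf.
Qed.

Lemma even_mid d : d \in darts W -> ~~ odd (size (mid d)).
Proof.
move=> dW; apply/negP => od; set S := even_set d.
have SP z : z \in S -> z \in mid d by rewrite inE => /andP [].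
have Sd d' : d' \in darts W -> hd d' \in S -> d' = d \/ d' = flip d.
  move=> d'W hS; have hm := SP _ hS; have := mem_mids dW hm.
  rewrite (hd_mids thW) // /hd; case E: (mid d') hm => [|z p] //=.
  rewrite /hd E /= => zd _; apply: (mid_inj thW dW d'W zd).
  by rewrite E mem_head.
have hdS : hd d \in S.
  by rewrite inE /hd; case: (mid d) od => //= z p _; rewrite mem_head eqxx.
have fW : flip d \in darts W by rewrite flip_darts.
have odf : odd (size (mid (flip d))) by rewrite size_rev.
have hfS : hd (flip d) \in S.
  rewrite /S -(even_set_flip dW od) inE /hd; case: (mid (flip d)) odf => //= z p _.
  by rewrite mem_head eqxx.
have oS : org d \notin S.
  by apply: contra (org_mids thW dW) => /SP; apply: mem_mids.
have inner d' p1 x p2 : d' \in darts W -> mid d' = p1 ++ x :: p2 ->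
    (last (org d') p1 \in S) = (head (dst d') p2 \in S).
  move=> d'W E.
  have dE : {d' = d} + {d' = flip d} + {d' != d /\ d' != flip d}.
    by have [->|] := eqVneq d' d; [left; left|have [->|] := eqVneq d' (flip d); [left; right | right]].
  case: dE => [[dE|dE]|[n1 n2]].
  - by subst d'; rewrite (even_set_last d'W E) (even_set_head d'W _ E).
  - by subst d'; rewrite /S -(even_set_flip dW od) (even_set_last d'W E) (even_set_head d'W odf E).
  - have out z : z \in mid d' -> z \notin S.
      move=> zd'; apply/negP => /SP zd; case: (mid_inj thW dW d'W zd zd') => /eqP.
        by rewrite (negPf n1).
      by rewrite (negPf n2).
    have out' z : z \notin mids W -> z \notin S.
      by move=> zB; apply: contra zB => /SP /(mem_mids dW).
    transitivity false; [|apply/esym]; apply/negbTE.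
      case: (lastP p1) E => [|q z] E; first by apply: out'; apply: (org_mids thW).
      by rewrite last_rcons; apply: out; rewrite E mem_cat mem_rcons mem_head.
    case: p2 E => [|z q] E; first by apply: out'; apply: (dst_mids thW).
    by apply: out; rewrite E mem_cat !inE eqxx !orbT.
(* For a closed thread both [d] and [flip d] leave the junction into [S], so [S] is a fort without
   this junction. *)
have [closed|open] := eqVneq (org d) (dst d).
  suff /only_setT ST : fort e S by rewrite ST inE in oS.
  apply: fort_threading => // [|d' d'W /Sd [//|->|->]].
  - by apply/set0Pn; exists (hd d).
  - by exists (flip d); split=> //; rewrite (flip_neq thW).
  - by exists d; split; rewrite // eq_sym (flip_neq thW).
suff /only_setT ST : fort e (~: S) by have := in_setT (hd d); rewrite -ST inE hdS.
apply: fort_threading => [|d' p1 x p2 d'W E|d' d'W].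
- by apply/set0Pn; exists (org d); rewrite inE.
- by rewrite !in_setC (inner _ _ _ _ d'W E).
rewrite in_setC => hd'.
(* Only [d] and [flip d] leave into [S], from different junctions. If [d'] alone left its origin
   outside [S], there would be just one other dart there, and [reduced] would make the two a closed
   thread, which [d] is not. *)
have [/hasP [d2 d2W /and3P [n2 /eqP o2 h2]]|] :=
  boolP (has (fun d2 => [&& d2 != d', org d2 == org d' & hd d2 \notin S]) (darts W)).
  by exists d2; rewrite in_setC.
move/hasPn => none; have inS d2 : d2 \in darts W -> d2 != d' -> org d2 = org d' -> hd d2 \in S.
  by move=> d2W n2 o2; have := none d2 d2W; rewrite n2 o2 eqxx /= negbK.
have [d2 [d2W n2 o2]] := another_dart d'W.
have h2 := inS d2 d2W n2 o2.
have E : d2 = flip d'.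
  apply: reducedP => // [|d3 d3W o3]; first by rewrite eq_sym.
  have [->|n3] := eqVneq d3 d'; [by left|right].
  have h3 := inS d3 d3W n3 o3; move: o3; rewrite -o2.
  case: (Sd _ d3W h3) (Sd _ d2W h2) => -> [] -> //= /eqP; rewrite /flip /org /= ?(negPf open) //.
  by rewrite eq_sym (negPf open).
have o2f : org d2 = dst d2 by rewrite o2 E.
move: open; case: (Sd _ d2W h2) o2f => -> oE.
  by rewrite oE eqxx.
by rewrite (oE : dst d = org d) eqxx.
Qed.

End Classes.


(** * The multigraph of junctions *)

Section Junctions.
Variables (T : finType) (e : rel T).
Implicit Types (a b x y z v w : T) (p q s : seq T) (d : thread T) (X : {set T}).
Variable W : seq (thread T).
Hypothesis thW : threading e W.
Hypothesis evenW : {in darts W, forall d, ~~ odd (size (mid d))}.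

(* The end of the thread through x that lies at even distance from x. *)
Definition parity_end x : T :=
  if [seq d <- W | x \in mid d] is d :: _
  then if odd (index x (mid d)) then org d else dst d
  else x.

Lemma parity_end_junction x : x \notin mids W -> parity_end x = x.
Proof.
move=> xB; rewrite /parity_end; case E: [seq _ <- _ | _] => [//|d s].
have : d \in [seq d <- W | x \in mid d] by rewrite E mem_head.
by rewrite mem_filter => /andP [xd dW]; case/negP: xB; apply/flatten_mapP; exists d.
Qed.

(** The orientation in the list does not matter: as the interior length is even, reversal changes
    the parity of the position and swaps the ends. *)
Lemma parity_end_mid d x : d \in darts W -> x \in mid d ->
  parity_end x = if odd (index x (mid d)) then org d else dst d.
Proof.
move=> dW xd; rewrite /parity_end; case E: [seq _ <- _ | _] => [|d' s].
  case/flatten_mapP: (mem_mids dW xd) => d' d'W xd'.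
  have : d' \in [seq d <- W | x \in mid d] by rewrite mem_filter xd' d'W.
  by rewrite E.
have : d' \in [seq d <- W | x \in mid d] by rewrite E mem_head.
rewrite mem_filter => /andP [xd' d'W].
have {}d'W : d' \in darts W by apply/dartsP; left.
have [->//|->] := mid_inj thW dW d'W xd xd'.
have := xd; rewrite -index_mem => lt; have um := uniq_mid thW dW.
rewrite index_rev // oddB //= (negPf (evenW dW)) /=.
by case: (odd _).
Qed.

Lemma parity_end_last d p1 x p2 : d \in darts W -> mid d = p1 ++ x :: p2 ->
  parity_end (last (org d) p1) = if odd (size p1) then dst d else org d.
Proof.
move=> dW E; have um := uniq_mid thW dW.
case: (lastP p1) E => [|q z] E /=; first exact/parity_end_junction/(org_mids thW).
have zd : z \in mid d by rewrite E mem_cat mem_rcons mem_head.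
rewrite last_rcons (parity_end_mid dW zd) size_rcons E cat_rcons index_split /=.
  by case: odd.
by rewrite -cat_rcons -E.
Qed.

Lemma parity_end_head d p1 x p2 : d \in darts W -> mid d = p1 ++ x :: p2 ->
  parity_end (head (dst d) p2) = if odd (size p1) then dst d else org d.
Proof.
move=> dW E; have um := uniq_mid thW dW.
case: p2 E => [|z q] E /=.
  rewrite parity_end_junction ?(dst_mids thW) //.
  by have := evenW dW; rewrite E size_cat addn1 /= negbK => ->.
have zd : z \in mid d by rewrite E mem_cat !inE eqxx !orbT.
rewrite (parity_end_mid dW zd) E -cat_rcons index_split ?size_rcons /= ?cat_rcons -?E //.
by case: odd.
Qed.

Lemma parity_end_hd d : d \in darts W -> parity_end (hd d) = dst d.
Proof.
move=> dW; rewrite /hd; case E: (mid d) => [|x p] /=.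
  exact/parity_end_junction/(dst_mids thW).
by rewrite (@parity_end_mid d) ?E ?mem_head //= eqxx.
Qed.

Lemma fort_around X d p1 x p2 : fort e X -> d \in darts W -> mid d = p1 ++ x :: p2 ->
  (last (org d) p1 \in X) = (head (dst d) p2 \in X).
Proof.
case/fortP => _ fX dW E; have [Nx neq] := edge_mid thW dW E.
apply/idP/idP => inX; apply: contraT => outX.
  case: (fX x (last (org d) p1)); apply/setP=> y; rewrite !inE Nx andb_orl.
  have [->|_] := eqVneq y (last _ _); first by rewrite inX.
  by have [->|//] := eqVneq y (head _ _); rewrite (negPf outX).
case: (fX x (head (dst d) p2)); apply/setP=> y; rewrite !inE Nx andb_orl.
have [->|_] := eqVneq y (last _ _); first by rewrite (negPf outX) (negPf neq) andbF.
by have [->|//] := eqVneq y (head _ _); rewrite inX.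
Qed.

(** Moves towards [dst d] two vertices at a time: the fort contains both or none of the neighbors of
    the vertex in between. *)
Lemma fort_suffix X d p1 p2 : fort e X -> d \in darts W -> mid d = p1 ++ p2 ->
  ~~ odd (size p2) -> (head (dst d) p2 \in X) = (dst d \in X).
Proof.
move=> fX dW; have [n] := ubnP (size p2).
elim: n => // n IH in p1 p2 *; case: p2 => [|z [|z' p]] //= lt E ev.
have := @fort_around X d (rcons p1 z) z' p fX dW.
rewrite cat_rcons last_rcons => -> //.
apply: (IH (p1 ++ [:: z; z'])); rewrite -?catA //; first by move: lt; rewrite ltnS => /ltnW.
by rewrite negbK in ev.
Qed.

Lemma fort_hd X d : fort e X -> d \in darts W -> (hd d \in X) = (dst d \in X).
Proof. by move=> fX dW; apply: (@fort_suffix X d [::]) => //; apply: evenW. Qed.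

(** As the interior length is even, [x] is at even distance along the thread from one of the
    ends. *)
Lemma fort_mid X d x : fort e X -> d \in darts W -> x \in mid d ->
  (x \in X) = (dst d \in X) \/ (x \in X) = (org d \in X).
Proof.
move=> fX dW xd; have ev := evenW dW.
case/splitPr E: _ / xd => [p1 p2].
have [od|od] := boolP (odd (size (x :: p2))); last by left; rewrite -(@fort_suffix X d p1 (x :: p2)).
right; have -> : x = head (dst (flip d)) (rev (rcons p1 x)) by rewrite rev_rcons.
apply: (@fort_suffix X (flip d) (rev p2)); rewrite ?flip_darts //.
  by rewrite /mid /= E -cat_rcons rev_cat.
by move: ev; rewrite E size_cat oddD od size_rev size_rcons /=; case: odd.
Qed.

Hypothesis only_setT : forall X, fort e X -> X = setT.

(** Otherwise the vertices whose [parity_end] is in [X] form a fort that misses [y]: interior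
    vertices have both or none of their neighbors in it, and it contains [hd d] exactly when [dst d]
    is in [X]. *)
Lemma junction_isolation X x y :
    x \notin mids W -> x \in X -> y \notin mids W -> y \notin X ->
  exists2 d, d \in darts W & dst d \in X /\
    {in darts W, forall d', org d' = org d -> dst d' \in X -> d' = d}.
Proof.
move=> xB xX yB yX.
have [/hasP [d dW /andP [dX /allP only]]|] := boolP (has (fun d => (dst d \in X) &&
    all (fun d' => (org d' == org d) && (dst d' \in X) ==> (d' == d)) (darts W)) (darts W)).
  by exists d => //; split=> // d' d'W od' d'X; have := only d' d'W; rewrite od' eqxx d'X => /eqP.
move/hasPn => none; case/negP: yX.
suff /only_setT ST : fort e [set z | parity_end z \in X].
  by have := in_setT y; rewrite -ST inE parity_end_junction.
apply: (fort_threading thW) => [|d p1 z p2 dW E|d dW].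
- by apply/set0Pn; exists x; rewrite inE parity_end_junction.
- by rewrite !inE (parity_end_last dW E) (parity_end_head dW E).
rewrite inE parity_end_hd // => dX; have := none d dW; rewrite dX /= => /allPn [d' d'W].
rewrite negb_imply => /andP [/andP [/eqP od d'X] neq].
by exists d'; split; rewrite // inE parity_end_hd.
Qed.

(** The adjacency matrix of the multigraph of junctions, with closed threads counted twice. *)
Definition mult v w : nat := count (fun d => (org d == v) && (dst d == w)) (darts W).

Lemma multC v w : mult v w = mult w v.
Proof.
rewrite /mult /darts; elim: W => //= d s ->.
rewrite -![org (flip d)]/(dst d).
by rewrite addnCA [(dst d == v) && _]andbC [(org d == v) && _]andbC.
Qed.

Lemma odd_multvv v : ~~ odd (mult v v).
Proof.
rewrite /mult /darts; elim: W => //= d s IH.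
rewrite -![org (flip d)]/(dst d).
by rewrite [(dst d == v) && _]andbC addnA oddD oddD addbb.
Qed.

Lemma mult_gt0P v w :
  reflect (exists d, [/\ d \in darts W, org d = v & dst d = w]) (0 < mult v w).
Proof.
rewrite -has_count; apply: (iffP hasP) => [[d dW /andP [/eqP ? /eqP ?]]|[d [dW <- <-]]].
  by exists d.
by exists d; rewrite ?eqxx.
Qed.

Lemma mult_gt0 d : d \in darts W -> 0 < mult (org d) (dst d).
Proof. by move=> dW; apply/mult_gt0P; exists d. Qed.

Lemma mult_gt0_junction v w : 0 < mult v w -> v \notin mids W.
Proof. by case/mult_gt0P => d [dW <- _]; apply: (org_mids thW). Qed.

Lemma mult_unique d : d \in darts W ->
  {in darts W, forall d', org d' = org d -> dst d' = dst d -> d' = d} ->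
  mult (org d) (dst d) = 1.
Proof.
move=> dW only; rewrite /mult -size_filter; apply/(perm_size (s2 := [:: d]))/uniq_perm => //.
  by rewrite filter_uniq //; case: thW.
move=> d'; rewrite mem_filter inE; apply/idP/eqP => [/andP [/andP [/eqP o1 /eqP o2] d'W]|->].
  exact: only.
by rewrite !eqxx.
Qed.

Lemma mult_gt1P v w :
  reflect (exists d1 d2, [/\ d1 \in darts W, d2 \in darts W, d1 != d2,
                            org d1 = v /\ dst d1 = w & org d2 = v /\ dst d2 = w])
          (1 < mult v w).
Proof.
have uD : uniq (darts W) by case: thW.
apply: (iffP idP) => [gt1|[d1 [d2 [d1W d2W neq [o1 t1] [o2 t2]]]]]; last first.
  rewrite /mult -size_filter -[2]/(size [:: d1; d2]).
  apply: uniq_leq_size; first by rewrite /= inE neq.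
  by move=> d; rewrite !inE mem_filter => /orP [] /eqP ->; rewrite ?o1 ?t1 ?o2 ?t2 !eqxx.
have /mult_gt0P [d1 [d1W o1 t1]] : 0 < mult v w by apply: ltnW.
have [/hasP [d2 d2W /and3P [n /eqP o2 /eqP t2]]|] :=
  boolP (has (fun d2 => [&& d1 != d2, org d2 == v & dst d2 == w]) (darts W)).
  by exists d1, d2.
move/hasPn => none; move: gt1; rewrite -o1 -t1 mult_unique // => d d2W od td.
by apply/eqP; have := none d d2W; rewrite od o1 td t1 !eqxx !andbT negbK eq_sym.
Qed.

Hypothesis redW : reduced W.
Hypothesis fortT : fort e setT.
Hypothesis several : exists x y, [/\ x != y, x \notin mids W & y \notin mids W].

(** The shape of row [v] of the matrix [mult]: [x] is the multiple neighbor and [w] the single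
    one. *)
Definition row x v w : bool :=
  [&& w != x, 1 < mult v x, mult v w == 1 & [forall y, (0 < mult v y) ==> (y == x) || (y == w)]].

(** Isolation in the complement of [x] gives a junction [v] with exactly one dart [d] that does not
    end in [x]. If only one other dart started at [v], [reduced] would make the two a closed thread
    at [x], yet [d] does not end there. *)
Lemma exists_row x : x \notin mids W -> exists v w, row x v w.
Proof.
move=> xB; have [y yx yB] : exists2 y, y != x & y \notin mids W.
  case: several => a [b [ab aB bB]]; have [ax|] := eqVneq a x; last by exists a.
  by exists b; rewrite // eq_sym -ax.
have [||d dW [dX only]] := @junction_isolation (~: [set x]) y x yB _ xB; rewrite ?inE ?eqxx //.
rewrite !inE in dX.
have onlyd d' : d' \in darts W -> org d' = org d -> dst d' != x -> d' = d.
  by move=> d'W od' d'X; apply: only; rewrite // !inE.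
exists (org d), (dst d); apply/and4P; split=> //.
- have [d1 [d1W n1 o1]] := another_dart thW fortT dW.
  have t1 : dst d1 = x by apply: contraNeq n1 => /(onlyd _ d1W o1) ->.
  apply/mult_gt1P; have [/hasP [d2 d2W /and3P [n2 n12 /eqP o2]]|] :=
    boolP (has (fun d2 => [&& d2 != d, d2 != d1 & org d2 == org d]) (darts W)).
    exists d1, d2; split=> //; first by rewrite eq_sym.
    by split=> //; apply: contraNeq n2 => /(onlyd _ d2W o2) ->.
  move/hasPn => none; case/eqP: dX; have E : d1 = flip d.
    apply: (reducedP redW) => //; first by rewrite eq_sym.
    move=> d2 d2W o2; have := none d2 d2W; rewrite o2 eqxx andbT negb_and !negbK.
    by case/orP => /eqP; [left|right].
  by rewrite -t1 E; rewrite E in o1.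
- by apply/eqP/mult_unique => // d' d'W o' t'; apply: onlyd; rewrite ?t'.
apply/forallP => z; apply/implyP => /mult_gt0P [d' [d'W o' <-]].
by have [//|n'] := eqVneq (dst d') x; rewrite (onlyd d' d'W o' n') eqxx.
Qed.

(** [phi] chooses for a junction [x] some [v] with multiple neighbor [x]. As [v] determines [x],
    this is an injection of the finite set of junctions into itself, hence onto. *)
Lemma exists_row_of v : v \notin mids W -> exists x w, row x v w.
Proof.
move=> vB; pose B := ~: [set x in mids W].
pose phi x := odflt x [pick v | [exists w, row x v w]].
have phiP x : x \in B -> exists w, row x (phi x) w.
  rewrite !inE => /exists_row [v1 [w1 r1]]; rewrite /phi; case: pickP => [v2 /existsP//|none].
  by have := none v1; rewrite (_ : [exists _, _]) //; apply/existsP; exists w1.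
have sub : phi @: B \subset B.
  apply/subsetP=> y /imsetP [x xB ->]; have [w /and4P [_ gt1 _ _]] := phiP x xB.
  by rewrite !inE; apply: (@mult_gt0_junction _ x); apply: ltnW.
have inj : {in B &, injective phi}.
  move=> x y xB yB E; have [w /and4P [_ gx _ _]] := phiP x xB.
  have [w' /and4P [_ _ /eqP my /forallP /(_ x)]] := phiP y yB.
  rewrite -E (ltnW gx) /= => /orP [/eqP //|/eqP xw].
  by move: gx; rewrite E xw my.
have : v \in phi @: B.
  suff -> : phi @: B = B by rewrite !inE.
  by apply/eqP; rewrite eqEcard sub card_in_imset ?leqnn.
by case/imsetP=> x xB ->; have [w r] := phiP x xB; exists x, w.
Qed.

(** The default value makes interior vertices fixed points, so that [multi] and [single] are
    involutions of the whole vertex type. *)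
Definition multi v := odflt v [pick x | 1 < mult v x].
Definition single v := odflt v [pick x | mult v x == 1].

Lemma rowE x v w : row x v w -> x = multi v /\ w = single v.
Proof.
case/and4P => wx gx /eqP mw /forallP only; split.
  rewrite /multi; case: pickP => [y gy|/(_ x)]; last by rewrite gx.
  have := only y; rewrite (ltnW gy) => /orP [/eqP //|/eqP yw].
  by move: gy; rewrite yw mw.
rewrite /single; case: pickP => [y /eqP my|/(_ w)]; last by rewrite mw.
have := only y; rewrite my => /orP [/eqP yx|/eqP //].
by move: gx; rewrite -yx my.
Qed.

Lemma multi_singleP v : v \notin mids W -> [/\ 1 < mult v (multi v), mult v (single v) = 1 &
  forall y, 0 < mult v y -> y = multi v \/ y = single v].
Proof.
case/exists_row_of => x [w r]; have [<- <-] := rowE r; case/and4P: r => _ -> /eqP -> /forallP only.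
by split=> // y gt; have := only y; rewrite gt => /orP [] /eqP; [left | right].
Qed.

Lemma multi_eq v x : 1 < mult v x -> x = multi v.
Proof.
move=> g; have vB := mult_gt0_junction (ltnW g).
have [_ ms /(_ x (ltnW g)) [//|xs]] := multi_singleP vB.
by move: g; rewrite xs ms.
Qed.

Lemma single_eq v x : mult v x = 1 -> x = single v.
Proof.
move=> m1; have g : 0 < mult v x by rewrite m1.
have [gm _ /(_ x g) [xs|//]] := multi_singleP (mult_gt0_junction g).
by move: gm; rewrite -xs m1.
Qed.

Lemma mid_mult v w : v \in mids W -> mult v w = 0.
Proof. by move=> vm; apply/eqP; rewrite -leqn0 leqNgt; apply: contraL vm => /mult_gt0_junction. Qed.

Lemma multi_mid v : v \in mids W -> multi v = v.
Proof. by move=> vm; rewrite /multi; case: pickP => // x; rewrite mid_mult. Qed.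

Lemma single_mid v : v \in mids W -> single v = v.
Proof. by move=> vm; rewrite /single; case: pickP => // x; rewrite mid_mult. Qed.

Lemma multiK : involutive multi.
Proof.
move=> v; have [vm|vB] := boolP (v \in mids W); first by rewrite !multi_mid.
by apply/esym/multi_eq; rewrite multC; case: (multi_singleP vB).
Qed.

Lemma singleK : involutive single.
Proof.
move=> v; have [vm|vB] := boolP (v \in mids W); first by rewrite !single_mid.
by apply/esym/single_eq; rewrite multC; case: (multi_singleP vB).
Qed.

Lemma multi_junction v : (multi v \in mids W) = (v \in mids W).
Proof.
have [vm|vB] := boolP (v \in mids W); first by rewrite multi_mid.
apply/negbTE/(@mult_gt0_junction _ v); rewrite multC.
by case: (multi_singleP vB) => /ltnW.
Qed.

Lemma single_junction v : (single v \in mids W) = (v \in mids W).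
Proof.
have [vm|vB] := boolP (v \in mids W); first by rewrite single_mid.
apply/negbTE/(@mult_gt0_junction _ v); rewrite multC.
by case: (multi_singleP vB) => _ ->.
Qed.

(** [mult v v] is even, while [mult v (single v)] is 1. *)
Lemma single_neq v : v \notin mids W -> single v != v.
Proof.
case/multi_singleP => _ m1 _; apply/eqP => E; have := odd_multvv v.
by rewrite -{2}E m1.
Qed.

(** Otherwise isolation in the complement of [O] gives a junction [v] with exactly one dart ending
    outside [O]. Then [multi v] is in [O] and [single v] is not, although [single \o multi] maps
    [multi v] to [single v]. *)
Lemma junctions_closed (O : {pred T}) x : x \notin mids W -> x \in O ->
    (forall y, y \in O -> single (multi y) \in O) ->
  forall y, y \notin mids W -> y \in O.
Proof.
move=> xB xO cl y yB; apply: contraT => yO.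
have [||d dW [dX only]] := @junction_isolation [set z | z \notin O] y x yB _ xB.
- by rewrite inE.
- by rewrite inE xO.
rewrite inE in dX; set v := org d in only.
have vB : v \notin mids W by apply: (org_mids thW).
have [/mult_gt1P [d1 [d2 [d1W d2W n [o1 t1] [o2 t2]]]] _ onlyms] := multi_singleP vB.
have mO : multi v \in O.
  apply: contraR n => mO; apply/eqP; transitivity d; [|apply/esym].
    by apply: only; rewrite ?inE ?t1.
  by apply: only; rewrite ?inE ?t2.
have [E|E] := onlyms (dst d) (mult_gt0 dW); first by rewrite E mO in dX.
by have := cl _ mO; rewrite multiK -E (negPf dX).
Qed.

End Junctions.

(** * The sequence of junctions *)


Section Zigzag.
Variables (T : finType) (mu sg : T -> T).
Hypotheses (muK : involutive mu) (sgK : involutive sg).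
Implicit Types (x y u : T).

(** [mu] conjugates [sg \o mu] to its inverse, as a reflection does with a rotation. *)
Lemma iter_conj i x :
  iter i (sg \o mu) (mu (iter i (sg \o mu) x)) = mu x.
Proof.
elim: i x => // i IH x; rewrite iterSr [iter i.+1 _ x]iterS /= muK sgK.
exact: IH.
Qed.

(* On an orbit of sg \o mu both mu and sg act as reflections of a cycle, and one of
   the two has a fixed point. *)
Lemma orbit_fixed_point x : fconnect (sg \o mu) x (mu x) ->
  exists2 y, fconnect (sg \o mu) x y & mu y = y \/ sg y = y.
Proof.
set rho := sg \o mu => con; pose j := findex rho x (mu x).
have Ej : iter j rho x = mu x by apply: iter_findex.
have inj : injective rho by apply: inj_comp; apply: can_inj.
have injn n : injective (iter n rho) by elim: n => // n IH y z /= /inj /IH.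
(* [mu x] is the [j]-th iterate of [x], and the fixed point lies halfway: iterate [j / 2] is fixed
   by [mu] if [j] is even, and iterate [(j + 1) / 2] by [sg] if [j] is odd. *)
have [od|od] := boolP (odd j); have := odd_double_half j; rewrite ?od ?(negPf od) => jE.
  exists (iter j./2.+1 rho x); first exact: fconnect_iter.
  right; set z := iter _ _ _.
  have mz : mu z = iter j./2 rho x.
    apply: (injn j./2.+1); rewrite /z iter_conj -Ej -[in LHS]jE -iterD.
    by congr (iter _ rho x); lia.
  by rewrite -[z in LHS]muK mz /z.
exists (iter j./2 rho x); first exact: fconnect_iter.
by left; apply: (injn j./2); rewrite iter_conj -Ej -[in LHS]jE -iterD addnn.
Qed.

Variable u : T.

Definition zigzag i : T := iteri i (fun k x => if odd k then mu x else sg x) u.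

Lemma zigzag_mu i : odd i -> zigzag i.+1 = mu (zigzag i).
Proof. by rewrite /zigzag /= => ->. Qed.

Lemma zigzag_sg i : ~~ odd i -> zigzag i.+1 = sg (zigzag i).
Proof. by rewrite /zigzag /= => /negPf ->. Qed.

Hypothesis mu_u : mu u = u.
Hypothesis sg_neq : forall i, sg (zigzag i) != zigzag i.

Lemma mu_zigzag i : ~~ odd i -> mu (zigzag i) = zigzag i.-1.
Proof.
case: i => [_|i]; first exact: mu_u.
by rewrite oddS negbK => od; rewrite zigzag_mu // muK.
Qed.

Lemma sg_zigzag i : odd i -> sg (zigzag i) = zigzag i.-1.
Proof. by case: i => // i; rewrite oddS => od; rewrite zigzag_sg // sgK. Qed.

(** Let [r + 1] be the first index repeating an earlier [zigzag j]. For [j < r] both images of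
    [zigzag j] are already its neighbors in the sequence (or itself, for [mu] at 0), so by
    injectivity [j = r]. As [sg] fixes no term, [r] is odd. *)
Lemma zigzag_turn : exists r, [/\ odd r, mu (zigzag r) = zigzag r & uniq (mkseq zigzag r.+1)].
Proof.
have ex : exists n, zigzag n \in mkseq zigzag n.
  have [/hasP [n]|/hasPn none] := boolP (has (fun n => zigzag n \in mkseq zigzag n) (iota 0 #|T|.+1)).
    by exists n.
  have : uniq (mkseq zigzag #|T|.+1).
    elim: #|T|.+1 none => // n IH none; rewrite -addn1 /mkseq iotaD map_cat cats1 rcons_uniq.
    rewrite none ?mem_iota //= IH // => m; rewrite mem_iota => mn; apply: none.
    by rewrite mem_iota; lia.
  by move/card_uniqP; rewrite size_mkseq => E; have := max_card (mem (mkseq zigzag #|T|.+1)); rewrite E ltnn.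
case: (ex_minnP ex) => -[|r] // /mapP [j]; rewrite mem_iota add0n => /andP [_ jr] Ej min.
have un : uniq (mkseq zigzag r.+1).
  have : forall m, m <= r.+1 -> uniq (mkseq zigzag m).
    elim=> // m IH mr; rewrite -addn1 /mkseq iotaD map_cat cats1 rcons_uniq IH ?(ltnW mr) // andbT.
    by apply/negP => /min; rewrite leqNgt mr.
  exact.
have inj i k : zigzag i = zigzag k -> i <= r -> k <= r -> i = k.
  move=> E ir kr; apply/eqP; rewrite -(nth_uniq u _ _ un) ?size_mkseq ?ltnS //.
  by rewrite !nth_mkseq // E.
exists r; have [od|ev] := boolP (odd r).
  move: Ej; rewrite zigzag_mu // => E; split=> //.
  have [oj|ej] := boolP (odd j); last first.
    have := mu_zigzag ej; rewrite -E muK => /inj H.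
    have : r = j.-1 by apply: H; lia.
    by lia.
  have [jE|jnr] := eqVneq j r; first by rewrite E jE.
  have := zigzag_mu oj; rewrite -E muK => /inj H.
  have : j.+1 = r by apply: H; lia.
  by lia.
move: Ej; rewrite zigzag_sg // => E.
have [oj|ej] := boolP (odd j).
  have := sg_zigzag oj; rewrite -E sgK => /inj H.
  have : r = j.-1 by apply: H; lia.
  by lia.
have [jE|jnr] := eqVneq j r; first by have := sg_neq r; rewrite E jE eqxx.
have := zigzag_sg ej; rewrite -E sgK => /inj H.
have : j.+1 = r by apply: H; lia.
by lia.
Qed.

End Zigzag.


(** * Reading off bouquets and dipoles from a threading *)

Lemma perm_partition_keys (S K : eqType) (key : S -> K) (ks : seq K) (s : seq S) :
  uniq ks -> all (fun x => key x \in ks) s ->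
  perm_eq s (flatten [seq [seq x <- s | key x == k] | k <- ks]).
Proof.
elim: ks s => [|k ks IH] s /=; first by case: s.
case/andP=> kks uks all_s.
apply: (perm_trans (y := [seq x <- s | key x == k] ++ [seq x <- s | key x != k])).
  by rewrite perm_sym; apply/permEl/perm_filterC.
rewrite perm_cat2l.
apply: (perm_trans (IH [seq x <- s | key x != k] uks _)).
  rewrite all_filter; apply: sub_all all_s => x /=; rewrite inE.
  by case: eqP.
suff /eq_in_map -> : {in ks, (fun k' => [seq x <- [seq x <- s | key x != k] | key x == k'])
    =1 (fun k' => [seq x <- s | key x == k'])} by [].
move=> k' k'ks; rewrite -filter_predI; apply: eq_filter => x /=.
by have [->|] := eqVneq (key x) k'; rewrite //= (memPn kks).
Qed.

Section Assembly.
Variables (T : finType) (e : rel T).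
Implicit Types (a b x y z v w : T) (p q s : seq T) (d : thread T) (X : {set T}).
Implicit Types W : seq (thread T).

Lemma has_darts_walk W x y :
  has (fun d => infix [:: x; y] (walk d)) (darts W) = has (consecutive x y) (map (@walk T) W).
Proof.
elim: W => // d W IH; rewrite -[has _ (darts _)]/([|| infix [:: x; y] (walk d),
  infix [:: x; y] (walk (flip d)) | has (fun d => infix [:: x; y] (walk d)) (darts W)]).
by rewrite IH infix_walk_flip orbA.
Qed.

Lemma threading_perm W : threading e W ->
  forall s, uniq s -> (forall x, (x \in s) = (x \notin mids W)) ->
  perm_eq (s ++ mids W) (enum T).
Proof.
case=> _ um _ _ s us sE; apply: uniq_perm; rewrite ?enum_uniq // ?cat_uniq ?us ?um ?andbT /=.
  by apply/hasPn => x xm; rewrite /= sE negbK.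
by move=> x; rewrite mem_cat sE orNb mem_enum.
Qed.

(** An empty interior would make the closed thread a loop. *)
Lemma even_cycle_order W d : threading e W -> irreflexive e -> d \in darts W ->
    org d = dst d -> ~~ odd (size (mid d)) ->
  (3 <= cycle_order (mid d)) && odd (cycle_order (mid d)).
Proof.
move=> th irr dW eq_ends ev; rewrite /cycle_order /= ev andbT.
have : mid d != [::].
  apply/eqP => E; have := edge_hd th dW; rewrite /hd E /= eq_ends irr.
  by [].
by case: (mid d) ev => [|z [|z' p]].
Qed.

Lemma threading_bouquet W c : threading e W -> irreflexive e ->
    {in darts W, forall d, ~~ odd (size (mid d))} ->
    (forall x, (x \notin mids W) = (x == c)) -> W != [::] ->
  odd_bouquet e.
Proof.
move=> th irr ev only W0; exists c, (map (@mid T) W).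
have inD d : d \in W -> d \in darts W by move=> dW; apply/dartsP; left.
have ends d : d \in W -> org d = c /\ dst d = c.
  by move=> /inD dW; split; apply/eqP; rewrite -only ?(org_mids th) ?(dst_mids th).
split.
  rewrite /odd_cycles size_map; apply/andP; split; first by case: (W) W0.
  rewrite all_map; apply/allP => d dW /=; have [o t] := ends d dW.
  by apply: (even_cycle_order th) => //; rewrite ?o ?t ?inD ?ev ?inD.
split.
  by apply: (threading_perm th (s := [:: c])) => // x; rewrite only inE.
move=> x y; case: (th) => _ _ -> _; rewrite has_darts_walk -map_comp; congr has.
by apply/eq_in_map => d dW /=; have [o t] := ends d dW; rewrite /walk o t.
Qed.

Lemma uniq_of_darts W : uniq (darts W) -> uniq W.
Proof.
elim: W => //= d W IH; rewrite /= => /and3P [+ _ /IH ->].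
rewrite inE negb_or andbT => /andP [_]; apply: contra => dW.
by apply/dartsP; left.
Qed.

Lemma same_threads_map_flip (f : pred (thread T)) W :
  same_threads W [seq if f d then d else flip d | d <- W].
Proof.
split; first by rewrite size_map.
  elim: W => //= d W IH; rewrite /mids /=; apply: perm_cat IH.
  by case: (f d); rewrite // perm_sym perm_rev.
elim: W => //= d W; rewrite -(perm_cons d) -(perm_cons (flip d)) => IH.
apply: (perm_trans (y := [:: flip d, d & darts W])).
  by apply/permP => a /=; rewrite addnCA.
apply: (perm_trans IH); case: (f d); rewrite /darts /= ?flipK //.
by apply/permP => a /=; rewrite addnCA.
Qed.

Lemma threading_dipole W (h : nat -> T) r :
    threading e W -> irreflexive e -> {in darts W, forall d, ~~ odd (size (mid d))} ->
    odd r -> uniq (mkseq h r.+1) -> (forall x, (x \in mkseq h r.+1) = (x \notin mids W)) ->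
    (forall d, d \in darts W -> exists2 i, i <= r &
       [\/ [/\ org d = h i, dst d = h i & i \in [:: 0; r]],
           [/\ i < r, org d = h i & dst d = h i.+1] |
           [/\ i < r, org d = h i.+1 & dst d = h i]]) ->
    0 < mult W (h 0) (h 0) -> 0 < mult W (h r) (h r) ->
    (forall i, i < r -> if odd i then 1 < mult W (h i) (h i.+1) else mult W (h i) (h i.+1) == 1) ->
  doubly_extended_bouquet_dipole e.
Proof.
move=> th0 irr ev0 odr uh hB adj0 mu0 mur mi0.
have r0 : 0 < r by case: r odr {uh hB adj0 mur mi0}.
pose idx x := index x (mkseq h r.+1).
have idxh i : i <= r -> idx (h i) = i.
  by move=> ir; rewrite /idx -(nth_mkseq (h 0) h (n := r.+1) (i := i)) ?index_uniq ?size_mkseq.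
(* All threads are turned to run from the smaller to the larger junction index; then the pair of
   ends tells to which group of the dipole a thread belongs. *)
pose W1 := [seq if idx (org d) <= idx (dst d) then d else flip d | d <- W].
have same : same_threads W W1 by apply: same_threads_map_flip.
have th := same_threading same th0; have [_ Pm Pd] := same.
have ev : {in darts W1, forall d, ~~ odd (size (mid d))}.
  by move=> d; rewrite -(perm_mem Pd); apply: ev0.
have mE v w : mult W v w = mult W1 v w by move/permP: Pd; apply.
have fwd d : d \in W1 -> idx (org d) <= idx (dst d).
  case/mapP => d' _ ->; case: ifP => // /negbT; rewrite -ltnNge; exact: ltnW.
have inD d : d \in W1 -> d \in darts W1 by move=> dW; apply/dartsP; left.
pose key d := (org d, dst d).
pose u := h 0; pose v := h r.
pose ks := [:: (u, u), (v, v) & [seq (h i, h i.+1) | i <- iota 0 r]].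
have hinj i j : i <= r -> j <= r -> h i = h j -> i = j.
  by move=> ir jr E; rewrite -(idxh i ir) E idxh.
have uks : uniq ks.
  rewrite /ks /= inE negb_or; apply/and3P; split.
  - apply/andP; split.
      by apply/eqP => -[/(hinj 0 r)]; lia.
    apply/negP => /mapP [i]; rewrite mem_iota add0n => /andP [_ ir] [_ /(hinj 0 i.+1)].
    by lia.
  - apply/negP => /mapP [i]; rewrite mem_iota add0n => /andP [_ ir] [/(hinj r i)].
    by lia.
  - rewrite map_inj_in_uniq ?iota_uniq // => i j; rewrite !mem_iota => ir jr [/hinj E _].
    by apply: E; lia.
have allk : all (fun d => key d \in ks) W1.
  apply/allP => d dW; have := fwd d dW; have := inD d dW.
  rewrite -(perm_mem Pd) => /adj0 [i ir []] [] => [o t|ir' o t|ir' o t]; rewrite /key o t.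
  - by rewrite !inE => /orP [] /eqP -> _; rewrite eqxx ?orbT.
  - move=> _; rewrite !inE; apply/or3P/Or33/mapP; exists i => //.
    by rewrite mem_iota add0n.
  - by rewrite !idxh //; lia.
have part := perm_partition_keys uks allk.
pose F k := [seq d <- W1 | key d == k].
have inF d k : d \in F k -> [/\ d \in W1, org d = k.1 & dst d = k.2].
  by rewrite mem_filter => /andP [/eqP <-].
pose P i := map (@mid T) (F (h i, h i.+1)).
pose C x := map (@mid T) (F (x, x)).
have oddC x : 0 < mult W x x -> odd_cycles (C x).
  rewrite mE => /mult_gt0P [d [dW o t]]; rewrite /odd_cycles size_map -has_predT.
  have [d' d'F] : exists d', d' \in F (x, x).
    case/dartsP: dW => dW; [exists d|exists (flip d)]; rewrite mem_filter dW andbT.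
      by rewrite /key o t.
    by rewrite -[key _]/(dst d, org d) o t.
  apply/andP; split; first by apply/hasP; exists d'.
  rewrite all_map; apply/allP => d2 /inF [d2W o2 t2] /=.
  by apply: (even_cycle_order th) => //; rewrite ?o2 ?t2 ?inD ?ev ?inD.
(* As the threads of [W1] run forward, each thread between [h i] and [h i.+1] contributes exactly
   one of its two darts to this count. *)
have sizeF i : i < r -> size (P i) = mult W (h i) (h i.+1).
  move=> ir; rewrite size_map size_filter mE /mult.
  have : all (fun d => (dst d != h i) || (org d != h i.+1)) W1.
    apply/allP => d /fwd le; rewrite -negb_and; apply/negP => /andP [/eqP t /eqP o].
    by move: le; rewrite o t !idxh; lia.
  elim: (W1) => //= d s IH /andP [nd /IH ->].
  rewrite -[(org (flip d) == _) && _]/((dst d == h i) && (org d == h i.+1)).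
  by rewrite -negb_and in nd; rewrite (negPf nd) /key xpair_eqE.
exists r, h, P, (C u), (C v); split=> //; [exact: oddC|exact: oddC| |].
  move=> i ir; split; first by rewrite sizeF //; have := mi0 i ir; case: odd.
    rewrite map_inj_in_uniq; first by rewrite filter_uniq // uniq_of_darts //; case: th.
    case=> [[a p] b] [[a' p'] b'] /inF [_ o t] /inF [_ o' t'].
    by move: (o : a = _) (o' : a' = _) (t : b = _) (t' : b' = _) => /= -> -> -> ->; rewrite /mid /= => ->.
  rewrite all_map; apply/allP => d /inF [dW _ _] /=.
  by rewrite /path_order /= negbK ev ?inD.
have midsF (s : seq (T * T)) : mids (flatten [seq F k | k <- s]) = flatten [seq flatten (map (@mid T) (F k)) | k <- s].
  by elim: s => //= k s <-; rewrite /mids map_cat flatten_cat.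
split.
  apply: (perm_trans (y := mkseq h r.+1 ++ mids W1)).
    rewrite perm_cat2l perm_sym; apply: perm_trans (perm_mids part) _.
    by rewrite midsF /ks /= -map_comp.
  apply: (threading_perm th) => // x.
  by rewrite hB (perm_mem Pm).
move=> x y; case: (th) => _ _ -> _; rewrite has_darts_walk.
have -> : has (consecutive x y) (map (@walk T) W1) =
   has (consecutive x y) (map (@walk T) (flatten [seq F k | k <- ks])).
  by apply: perm_has; apply: perm_map.
have walkF a b : map (@walk T) (F (a, b)) = map (path_walk a b) (map (@mid T) (F (a, b))).
  by rewrite -map_comp; apply/eq_in_map => d /inF [_ o t] /=; rewrite /walk o t.
rewrite /ks /= !map_cat !walkF; congr (has _ (_ ++ _ ++ _)).
by rewrite map_flatten -!map_comp; congr flatten; apply: eq_map => i /=; apply: walkF.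
Qed.

End Assembly.


(** * Graphs whose vertex set is the only fort *)

Section Full.
Variables (T : finType) (e : rel T).
Hypotheses (e_sym : symmetric e) (e_irr : irreflexive e).
Hypotheses (fortT : fort e setT) (only_setT : forall X, fort e X -> X = setT).

Lemma several_junctions_dipole W x y :
    threading e W -> reduced W -> x != y -> x \notin mids W -> y \notin mids W ->
  doubly_extended_bouquet_dipole e.
Proof.
move=> th red xy xB yB; have ev := even_mid th red fortT only_setT.
have several : exists x y, [/\ x != y, x \notin mids W & y \notin mids W] by exists x, y.
pose mu := multi W; pose sg := single W.
have muK : involutive mu := multiK th ev only_setT red fortT several.
have sgK : involutive sg := singleK th ev only_setT red fortT several.
have muB z : (mu z \in mids W) = (z \in mids W) := multi_junction th ev only_setT red fortT several z.
have sgB z : (sg z \in mids W) = (z \in mids W) := single_junction th ev only_setT red fortT several z.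
have sgN z : z \notin mids W -> sg z != z := @single_neq _ _ _ th ev only_setT red fortT several z.
have closed := @junctions_closed _ _ _ th ev only_setT red fortT several.
have spec z := @multi_singleP _ _ _ th ev only_setT red fortT several z.
have orbB z : fconnect (sg \o mu) x z -> z \notin mids W.
  move=> con; rewrite -(iter_findex con); elim: findex => //= n IH.
  by rewrite sgB muB.
have orb : forall z, z \notin mids W -> fconnect (sg \o mu) x z.
  apply: (closed [pred z | fconnect (sg \o mu) x z] x) => // [|z]; first exact: connect0.
  by move=> con; apply: connect_trans con _; apply: fconnect1.
(* By transitivity on the junctions, [mu x] lies in the orbit of [x]. As [sg] fixes no junction, the
   fixed point obtained is one of [mu]. *)
have [|u uc fixu] := @orbit_fixed_point _ mu sg muK sgK x.
  by apply: orb; rewrite muB.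
have uB := orbB u uc; have {fixu} mu_u : mu u = u.
  by case: fixu => // E; have := sgN u uB; rewrite E eqxx.
pose h := zigzag mu sg u.
have hB i : h i \notin mids W.
  elim: i => // i IH; have [od|od] := boolP (odd i).
    by rewrite /h zigzag_mu // muB.
  by rewrite /h zigzag_sg // sgB.
have [|r [odr mur uh]] := @zigzag_turn _ mu sg muK sgK u mu_u.
  by move=> i; apply/sgN/hB.
have lt_even i : ~~ odd i -> i <= r -> i < r.
  by move=> ev_i ir; rewrite ltn_neqAle ir andbT; apply: contraNneq ev_i => ->.
have muh i : i <= r -> exists2 j, j <= r & mu (h i) = h j.
  move=> ir; have [od|od] := boolP (odd i); last first.
    by exists i.-1; [lia | apply: mu_zigzag].
  have [->|n] := eqVneq i r; first by exists r.
  by exists i.+1; [lia | rewrite /h zigzag_mu].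
have sgh i : i <= r -> exists2 j, j <= r & sg (h i) = h j.
  move=> ir; have [od|od] := boolP (odd i).
    by exists i.-1; [lia | apply: sg_zigzag].
  by exists i.+1; [lia | rewrite /h zigzag_sg].
have inh z : reflect (exists2 i, i <= r & z = h i) (z \in mkseq h r.+1).
  apply: (iffP mapP) => -[i ir ->]; exists i => //.
    by rewrite mem_iota add0n ltnS in ir.
  by rewrite mem_iota add0n ltnS.
(* The listed vertices are closed under [mu] and [sg], so transitivity makes them all the
   junctions. *)
have allh z : z \notin mids W -> z \in mkseq h r.+1.
  apply: (closed [pred z | z \in mkseq h r.+1] u) => // [|t /inh [i ir ->]].
    by apply/inh; exists 0.
  have [j jr jE] := muh i ir; have [k kr kE] := sgh j jr.
  by apply/inh; exists k; rewrite // -kE -jE.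
apply: (@threading_dipole _ e W h r) => //.
- by move=> z; apply/idP/idP => [/inh [i _ ->] //|]; apply: allh.
- move=> d dW; have oB := org_mids th dW.
  have /inh [i ir oE] := allh _ oB.
  have [_ _ /(_ _ (mult_gt0 dW))] := spec _ oB.
  rewrite [in multi _ _]oE [in single _ _]oE => -[] tE; have [od|od] := boolP (odd i).
  + have [iE|n] := eqVneq i r.
      by exists r => //; constructor 1; rewrite iE in oE tE; split=> //; [rewrite tE | rewrite !inE eqxx orbT].
    by exists i => //; constructor 2; split; rewrite ?tE /h ?zigzag_mu // ltn_neqAle n.
  + case: i ir od oE tE => [|i] ir od oE tE.
      by exists 0 => //; constructor 1; split=> //; rewrite tE.
    by exists i; [exact: ltnW | constructor 3; split; rewrite // tE; apply: mu_zigzag].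
  + exists i.-1; first exact: leq_trans (leq_pred i) ir.
    by constructor 3; case: i ir od oE tE => // i ir od oE tE; split; rewrite // tE; apply: sg_zigzag.
  + by exists i => //; constructor 2; split; rewrite ?tE /h ?zigzag_sg // lt_even.
- by have [/ltnW + _ _] := spec _ uB; rewrite -/mu mu_u.
- by have [/ltnW + _ _] := spec _ (hB r); rewrite -/mu mur.
move=> i ir; have [g1 m1 _] := spec _ (hB i); have [od|od] := boolP (odd i).
  by rewrite /h zigzag_mu.
by rewrite /h zigzag_sg // m1.
Qed.

Lemma only_full_fort : 0 < #|T| ->
  edgeless_graph e \/ doubly_extended_bouquet_dipole e \/ odd_bouquet e.
Proof.
case/card_gt0P => x0 _; have [W [th red]] := threading_reduced e_sym e_irr.
have ev := even_mid th red fortT only_setT.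
have [W0|W0] := eqVneq W [::].
  by left=> x y; case: (th) => _ _ -> _; rewrite W0.
right; have [c cB] : exists c, c \notin mids W.
  case: (W) W0 th => // d s _ th; exists (org d).
  by apply: (org_mids th); apply/dartsP; left; rewrite mem_head.
have [/existsP [y /andP [yc yB]]|] := boolP [exists y, (c != y) && (y \notin mids W)].
  by left; apply: (several_junctions_dipole th red yc).
rewrite negb_exists => /forallP one; right.
apply: (threading_bouquet (c := c) th) => // x.
apply/idP/eqP => [xB|->//]; have := one x; rewrite xB andbT negbK.
by move/eqP.
Qed.

End Full.

(** * From span zero to the five families *)

Lemma skew_span0_families (T : finType) (e : rel T) :
    symmetric e -> irreflexive e -> 0 < #|T| -> skew_span e = 0 ->
  complete_graph e \/ edgeless_graph e \/ doubly_extended_bouquet_dipole e \/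
  odd_bouquet e \/ two_set_perfectly_orderable e.
Proof.
move=> e_sym e_irr T0 /skew_span0_min_fort [nofort|[t /andP [t0 tn] forts]].
  by do 4!right; apply: no_fort_orderable.
have [t1|t1] := eqVneq t 1.
  right; left=> x y; apply/negP => exy.
  have /fortP [_ /(_ x y)] : fort e [set y] by apply: (proj2 (forts _)); rewrite cards1 t1.
  by case; apply/setIidPr; rewrite sub1set inE.
have [tE|tT] := eqVneq t #|T|; last first.
  by left; apply: (fort_threshold_complete (t := t)) => //; lia.
have fortT : fort e setT by apply: (proj2 (forts _)); rewrite cardsT tE.
have only X : fort e X -> X = setT.
  by move/(proj1 (forts _)); rewrite tE => cX; apply/eqP; rewrite eqEcard subsetT cardsT.
by case: (only_full_fort e_sym e_irr fortT only T0) => [|[]]; tauto.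
Qed.

(** * Bouquets and dipoles have span zero *)


Lemma uniq_of_flatten (S : eqType) (s : seq (seq S)) :
  uniq (flatten s) -> [::] \notin s -> uniq s.
Proof.
elim: s => //= p s IH; rewrite cat_uniq inE negb_or => /and3P [_ /hasPn dis us] /andP [p0 s0].
rewrite IH // andbT; apply/negP => ps; case: p p0 dis ps => // x p _ dis ps.
have /dis : x \in flatten s by apply/flattenP; exists (x :: p); rewrite ?mem_head.
by rewrite /= mem_head.
Qed.

Lemma uniq_flatten_map (I S : eqType) (F : I -> seq S) (s : seq I) :
    uniq s -> {in s, forall i, uniq (F i)} ->
    {in s &, forall i j x, x \in F i -> x \in F j -> i = j} ->
  uniq (flatten (map F s)).
Proof.
elim: s => //= i s IH /andP [is_ us] uF inj; rewrite cat_uniq uF ?mem_head //=.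
rewrite IH // ?andbT => [|j js|j k js ks]; first last.
- by apply: inj; rewrite inE ?js ?ks orbT.
- by apply: uF; rewrite inE js orbT.
apply/hasPn => x /flatten_mapP [j js xj]; apply/negP => xi.
by move: is_; rewrite (inj i j _ _ x) ?js ?mem_head // inE js orbT.
Qed.

(* The order of propagation is 0, 1, 3, .., r, r - 1, r - 3, .., 0. *)
Lemma zigzag_propagation (Y : pred nat) r :
    odd r -> (forall i, i < r -> ~~ odd i -> Y i.-1 -> Y i.+1) ->
    (forall i, i < r -> ~~ odd i -> Y (minn i.+2 r) -> Y i) ->
  forall j, j <= r -> Y j -> forall i, i <= r -> Y i.
Proof.
move=> odr up down; have r0 : 0 < r by case: r odr {up down}.
(* [up] leads from an odd index to the next one, and from 0 to 1 since [0.-1 = 0]; [down] leads back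
   along the even indices, starting from [r] to [r.-1], where the minimum is [r]. *)
have odd_up n j : odd j -> j + n.*2 <= r -> Y j -> Y (j + n.*2).
  elim: n => [|n IH] oj jr hX; first by rewrite addn0.
  rewrite doubleS !addnS; apply: (up (j + n.*2).+1); [lia | by rewrite /= oddD odd_double oj|].
  by apply: IH => //; lia.
have even_down n j : ~~ odd j -> j + n.*2 <= r -> Y (j + n.*2) -> Y j.
  elim: n => [|n IH] ej jr; first by rewrite addn0.
  move=> hX; apply: IH => //; first by lia.
  apply: down; [lia | by rewrite oddD odd_double (negPf ej)|].
  by rewrite (minn_idPl _) //; move: hX jr; rewrite doubleS !addnS.
have to_r j : odd j -> j <= r -> Y j -> Y r.
  move=> oj jr hX; have -> : r = j + (r - j)./2.*2 by lia.
  by apply: odd_up => //; lia.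
have r_to_0 : Y r -> Y 0.
  move=> hX; apply: (even_down r./2) => //; first by lia.
  have -> : 0 + r./2.*2 = r.-1 by lia.
  by apply: down; rewrite ?(minn_idPr _) //; lia.
have zero_one : Y 0 -> Y 1 by move=> h0; apply: (up 0).
move=> j jr hX; have h0 : Y 0.
  have [oj|ej] := boolP (odd j); first exact: r_to_0 (to_r j oj jr hX).
  by apply: (even_down j./2) => //; rewrite add0n (even_halfK ej).
have h1 := zero_one h0.
have hr : Y r by apply: (to_r 1).
move=> i ir; have [oi|ei] := boolP (odd i).
  have -> : i = 1 + i./2.*2 by lia.
  by apply: odd_up => //; lia.
have hr1 : Y r.-1 by apply: down; rewrite ?(minn_idPr _) //; lia.
apply: (even_down (r.-1 - i)./2) => //; first by lia.
by have -> : i + (r.-1 - i)./2.*2 = r.-1 by lia.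
Qed.

Section Backward.
Variables (T : finType) (e : rel T).
Implicit Types (a b x y z v w : T) (p q s : seq T) (d : thread T) (X : {set T}).
Implicit Types W : seq (thread T).

(** The point is uniqueness of darts. If [d1 = flip d2], the thread is closed with at least two
    interior vertices; disjointness of interiors gives [d1 = d2], so this interior would be a
    palindrome without repetitions. *)
Lemma threading_of_walks W s :
    perm_eq (s ++ mids W) (enum T) ->
    (forall x y, e x y = has (consecutive x y) (map (@walk T) W)) ->
    uniq W -> {in W, forall d, org d \in s /\ dst d \in s} ->
    {in W, forall d, org d = dst d -> 1 < size (mid d)} ->
    {in W &, forall d1 d2, org d1 = dst d2 -> dst d1 = org d2 -> org d1 = dst d1} ->
  threading e W /\ forall x, (x \notin mids W) = (x \in s).
Proof.
move=> pT edges uW ends closed asym.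
have : uniq (s ++ mids W) by rewrite (perm_uniq pT) enum_uniq.
rewrite cat_uniq => /and3P [_ /hasPn dis um].
have sE x : (x \notin mids W) = (x \in s).
  apply/idP/idP => [|xs]; last by apply/negP => /dis; rewrite /= xs.
  by have : x \in s ++ mids W; [rewrite (perm_mem pT) mem_enum | rewrite mem_cat => /orP [//|->]].
split=> //; split=> //.
- by move=> d; rewrite sE => /dartsP [] /ends [].
- by move=> x y; rewrite has_darts_walk.
apply: uniq_darts => // d1 d2 d1W d2W; apply/eqP => E.
have [o t] : org d1 = dst d2 /\ dst d1 = org d2 by rewrite E.
have cl := asym _ _ d1W d2W o t; have := closed _ d1W cl.
have Em : mid d1 = rev (mid d2) by rewrite E.
have dE : d1 = d2.
  case E1: (mid d1) => [|x p]; first by have := closed _ d1W cl; rewrite E1.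
  have x1 : x \in mid d1 by rewrite E1 mem_head.
  have x2 : x \in mid d2 by rewrite -mem_rev -Em.
  elim: (W) um d1W d2W x1 x2 => //= d s' IH; rewrite /mids /= cat_uniq => /and3P [_ /hasPn dis' um'].
  rewrite !inE => /orP [/eqP->|in1] /orP [/eqP->|in2] x1 x2 //; last exact: IH.
    have /dis' : x \in flatten (map (@mid T) s') by apply/flatten_mapP; exists d2.
    by rewrite /= x1.
  have /dis' : x \in flatten (map (@mid T) s') by apply/flatten_mapP; exists d1.
  by rewrite /= x2.
have : uniq (mid d2).
  elim: (W) um d2W => //= d s' IH; rewrite /mids /= cat_uniq => /and3P [ud _ um'].
  by rewrite inE => /orP [/eqP ->|]; last exact: IH.
rewrite {1}dE; move: Em; rewrite dE; case: (mid d2) => [|x p] //=; rewrite rev_cons.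
case: (lastP p) => // p' z; rewrite rev_rcons /= => -[-> _].
by rewrite mem_rcons mem_head.
Qed.

Section Forts.
Variables (W : seq (thread T)) (X : {set T}).
Hypothesis thW : threading e W.
Hypothesis evenW : {in darts W, forall d, ~~ odd (size (mid d))}.
Hypothesis fX : fort e X.

(** An interior vertex agrees with one of its two ends on membership in [X], so [X] is everything or
    empty, and a fort is not empty. *)
Lemma fort_junctions (c : bool) : (forall x, x \notin mids W -> (x \in X) = c) -> X = setT.
Proof.
move=> Xc; have {}Xc x : (x \in X) = c.
  have [|/Xc //] := boolP (x \in mids W).
  case/(midsP W) => d dW xd.
  by case: (fort_mid thW evenW fX dW xd) => ->; apply: Xc; rewrite ?(org_mids thW) ?(dst_mids thW).
case/fortP: fX => /set0Pn [x xX] _; apply/setP=> y.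
by rewrite Xc inE -xX Xc.
Qed.

(** Forcing along a whole thread: otherwise [hd d] would be the only neighbor of [org d] in [X]. *)
Lemma fort_dart d : d \in darts W ->
  {in darts W, forall d', org d' = org d -> d' != d -> dst d' \notin X} -> dst d \notin X.
Proof.
move=> dW others; apply/negP => dX.
case/fortP: (fX) => _ /(_ (org d) (hd d)); case; apply/setP=> y; rewrite !inE.
apply/andP/eqP => [[ey yX]|->]; last by rewrite (edge_hd thW) // (fort_hd thW).
have [d' [d'W o' y']] := edge_org thW (org_mids thW dW) ey.
have [<- //|n] := eqVneq d' d.
by have := others d' d'W o' n; rewrite -(fort_hd thW evenW fX) // y' yX.
Qed.

End Forts.

Lemma bouquet_span0 : odd_bouquet e -> skew_span e = 0.
Proof.
case=> c [C [/andP [_ /allP oddC] [pT edges]]]; apply: skew_span0_full => X fX.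
pose W := [seq (c, p, c) : thread T | p <- C].
have mW : map (@mid T) W = C by rewrite -map_comp map_id.
have uC : uniq C.
  apply: uniq_of_flatten; last by apply/negP => /oddC.
  have : uniq (c :: flatten C) by rewrite (perm_uniq pT) enum_uniq.
  by case/andP.
have [|||||| th B] := @threading_of_walks W [:: c].
- by rewrite /mids mW.
- by move=> x y; rewrite edges -map_comp.
- by rewrite map_inj_uniq // => p q [].
- by move=> d /mapP [p _ ->]; rewrite inE.
- by move=> d /mapP [p /oddC /andP [+ _] ->].
- by move=> d1 d2 /mapP [p _ ->].
apply: (fort_junctions th _ fX (c := c \in X)) => [d|x].
  have evp p : p \in C -> ~~ odd (size p) by case/oddC/andP.
  by case/dartsP => /mapP [p /evp + E]; [rewrite E | rewrite -(size_rev (mid d)) -[rev _]/(mid (flip d)) E].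
by rewrite B inE => /eqP ->.
Qed.

(** If one junction lies outside the fort [X], forcing along the single threads puts all of them
    outside. So [X] contains all junctions or none, and [fort_junctions] applies. *)
Lemma dipole_span0 : doubly_extended_bouquet_dipole e -> skew_span e = 0.
Proof.
case=> r [h [P [Cu [Cv /= [odr oddu oddv PP [pT edges]]]]]].
apply: skew_span0_full => X fX.
set u := h 0 in edges pT; set v := h r in edges pT.
pose Wu := [seq (u, p, u) : thread T | p <- Cu].
pose Wv := [seq (v, p, v) : thread T | p <- Cv].
pose WP i := [seq (h i, p, h i.+1) : thread T | p <- P i].
pose W := Wu ++ Wv ++ flatten [seq WP i | i <- iota 0 r].
have mW : mids W = flatten Cu ++ flatten Cv ++ flatten [seq flatten (P i) | i <- iota 0 r].
  rewrite /mids !map_cat !flatten_cat -!map_comp !map_id; congr (_ ++ (_ ++ _)).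
  elim: (iota 0 r) => //= i s <-; rewrite map_cat flatten_cat -map_comp.
  by rewrite map_id.
have uT : uniq (mkseq h r.+1 ++ mids W) by rewrite mW (perm_uniq pT) enum_uniq.
have uh : uniq (mkseq h r.+1) by move: uT; rewrite cat_uniq => /and3P [].
have hinj i j : h i = h j -> i <= r -> j <= r -> i = j.
  move=> E ir jr; apply/eqP; rewrite -(nth_uniq u _ _ uh) ?size_mkseq ?ltnS //.
  by rewrite !nth_mkseq // E.
have um : uniq (mids W) by move: uT; rewrite cat_uniq => /and3P [].
have r0 : 0 < r by case: (r) odr.
have inW d : d \in W -> [\/ exists2 p, p \in Cu & d = (u, p, u),
    exists2 p, p \in Cv & d = (v, p, v) |
    exists i, [/\ i < r, mid d \in P i & d = (h i, mid d, h i.+1)]].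
  rewrite !mem_cat => /or3P [/mapP [p pC ->]|/mapP [p pC ->]|/flatten_mapP [i]].
  - by constructor 1; exists p.
  - by constructor 2; exists p.
  rewrite mem_iota => /andP [_ ir] /mapP [p pP ->]; constructor 3; exists i; split=> //.
have hin i : i <= r -> h i \in mkseq h r.+1 by move=> ir; apply: map_f; rewrite mem_iota.
have uCu : uniq Cu.
  apply: uniq_of_flatten; last by case/andP: oddu => _ /allP H; apply/negP => /H.
  by move: um; rewrite mW cat_uniq => /and3P [].
have uCv : uniq Cv.
  apply: uniq_of_flatten; last by case/andP: oddv => _ /allP H; apply/negP => /H.
  by move: um; rewrite mW !cat_uniq => /and3P [_ _ /and3P []].
have neqS i : i < r -> h i <> h i.+1 by move=> ir /hinj; lia.
have [|||||| th B] := @threading_of_walks W (mkseq h r.+1).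
- by rewrite mW.
- move=> x y; rewrite edges !map_cat -!map_comp; congr (has _ (_ ++ (_ ++ _))).
  by elim: (iota 0 r) => //= i s ->; rewrite map_cat -map_comp.
- have nWP d : d \in flatten [seq WP i | i <- iota 0 r] -> org d <> dst d.
    by case/flatten_mapP => i; rewrite mem_iota => /andP [_ ir] /mapP [p _ ->]; apply: neqS.
  rewrite !cat_uniq; apply/and3P; split; first by rewrite map_inj_uniq // => p q [].
    apply/hasPn => d; rewrite mem_cat => /orP [/mapP [p _ ->]|dP]; apply/negP => /mapP [q _].
      by case=> /hinj; lia.
    by move=> E; apply: (nWP d dP); rewrite E.
  apply/and3P; split; first by rewrite map_inj_uniq // => p q [].
    by apply/hasPn => d dP; apply/negP => /mapP [q _ E]; apply: (nWP d dP); rewrite E.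
  apply: uniq_flatten_map; first exact: iota_uniq.
    move=> i; rewrite mem_iota => /andP [_ ir]; rewrite map_inj_uniq; last by move=> p q [].
    by case: (PP i ir).
  move=> i j; rewrite !mem_iota => /andP [_ ir] /andP [_ jr] d /mapP [p _ ->] /mapP [q _ [/hinj E _]].
  by move=> _; apply: E; apply: ltnW.
- move=> d /inW [[p _ ->]|[p _ ->]|[i [ir _ ->]]]; split; apply: hin; rewrite // ltnW //.
- move=> d /inW [[p pC ->]|[p pC ->]|[i [ir _ ->]]] /=.
  + by case/andP: oddu => _ /allP /(_ p pC) /andP [].
  + by case/andP: oddv => _ /allP /(_ p pC) /andP [].
  + by move/neqS.
- move=> d1 d2 /inW [[p pC ->]|[p pC ->]|[i [ir _ ->]]] //.
  case/inW => [[q _ ->]|[q _ ->]|[j [jr _ ->]]] /=.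
  + by move=> E1 E2; rewrite [LHS]E1 [RHS]E2.
  + by move=> E1 E2; rewrite [LHS]E1 [RHS]E2.
  + by move=> /hinj E1 /hinj E2; lia.
have ev : {in darts W, forall d, ~~ odd (size (mid d))}.
  have evW d : d \in W -> ~~ odd (size (mid d)).
    case/inW => [[p pC ->]|[p pC ->]|[i [ir pP _]]].
    + by case/andP: oddu => _ /allP /(_ p pC) /andP [_].
    + by case/andP: oddv => _ /allP /(_ p pC) /andP [_].
    by case: (PP i ir) => _ _ /allP /(_ _ pP); rewrite /path_order /= negbK.
  by move=> d /dartsP [] /evW //; rewrite size_rev.
have single i : i < r -> ~~ odd i -> exists2 p, P i = [:: p] & (h i, p, h i.+1) \in W.
  move=> ir /negPf od; have [+ _ _] := PP i ir; rewrite od.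
  case E : (P i) => [|p [|]] // _; exists p => //.
  rewrite !mem_cat; apply/or3P/Or33/flatten_mapP; exists i; rewrite ?mem_iota //.
  by rewrite /WP E mem_head.
(* Apart from the single thread to [h i.+1], every dart at [h i] ends in [h i.-1]; for [i = 0] these
   darts are closed. *)
have up i : i < r -> ~~ odd i -> h i.-1 \notin X -> h i.+1 \notin X.
  move=> ir od hX; have [p Pp dW] := single i ir od.
  apply: (fort_dart th ev fX (d := (h i, p, h i.+1))); first by apply/dartsP; left.
  move=> d dW' o n; suff -> : dst d = h i.-1 by [].
  have u0 : u = h i -> dst d = u -> dst d = h i.-1.
    by move/hinj => i0 ->; rewrite -i0 //; apply: ltnW.
  have nv : v <> h i by move/hinj; clear -ir; lia.
  case/dartsP: dW' => /inW [[q _ E]|[q _ E]|[k [kr qk E]]].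
  - by apply: u0; rewrite -?[RHS]o E.
  - by case: nv; rewrite -[RHS]o E.
  - have /hinj ki : h k = h i by rewrite -[RHS]o E.
    have {}ki : k = i by apply: ki; apply: ltnW.
    by case/eqP: n; rewrite E ki; move: qk; rewrite ki Pp inE => /eqP ->.
  - by apply: u0; rewrite -?[RHS]o -[d]flipK E.
  - by case: nv; rewrite -[RHS]o -[d]flipK E.
  - have /hinj ki : h k.+1 = h i by rewrite -[RHS]o -[d]flipK E.
    have <- : k.+1 = i by apply: ki => //; apply: ltnW.
    by rewrite -[d]flipK E.
(* The other darts at [h i.+1] end in [h i.+2], or are closed if [i.+1 = r]; [minn] covers both
   cases. *)
have down i : i < r -> ~~ odd i -> h (minn i.+2 r) \notin X -> h i \notin X.
  move=> ir od hX; have [p Pp dW] := single i ir od.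
  apply: (fort_dart th ev fX (d := flip (h i, p, h i.+1))); first by rewrite flip_darts; apply/dartsP; left.
  move=> d dW' o n; suff -> : dst d = h (minn i.+2 r) by [].
  have nu : u <> h i.+1 by move/hinj; clear -ir; lia.
  have vr : v = h i.+1 -> dst d = v -> dst d = h (minn i.+2 r).
    by move/hinj => ri ->; congr h; move: ri ir; clear; lia.
  case/dartsP: dW' => /inW [[q _ E]|[q _ E]|[k [kr qk E]]].
  - by case: nu; rewrite -[RHS]o E.
  - by apply: vr; rewrite -?[RHS]o E.
  - have /hinj ki : h k = h i.+1 by rewrite -[RHS]o E.
    have {}ki : k = i.+1 by apply: ki => //; apply: ltnW.
    by rewrite E ki /dst /=; congr h; move: ki kr; clear; lia.
  - by case: nu; rewrite -[RHS]o -[d]flipK E.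
  - by apply: vr; rewrite -?[RHS]o -[d]flipK E.
  - have /hinj ki : h k.+1 = h i.+1 by rewrite -[RHS]o -[d]flipK E.
    have {}ki : k = i by apply/succn_inj/ki.
    case/eqP: n; rewrite -[d]flipK E ki; move: qk; rewrite ki Pp inE => /eqP -> //.
have all_out := zigzag_propagation (Y := fun i => h i \notin X) odr up down.
have [/hasP [j]|/hasPn none] := boolP (has (fun j => h j \notin X) (iota 0 r.+1)).
  rewrite mem_iota ltnS => /andP [_ jr] hX.
  apply: (fort_junctions th ev fX (c := false)) => x; rewrite B => /mapP [i].
  by rewrite mem_iota ltnS => /andP [_ ir] ->; apply/negbTE/(all_out j jr hX).
apply: (fort_junctions th ev fX (c := true)) => x; rewrite B => /mapP [i ir ->].
by apply/negbNE/none.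
Qed.

End Backward.

Theorem theorem9 (T : finType) (e : rel T)
    (e_sym : symmetric e) (e_irr : irreflexive e) (T_gt0 : 0 < #|T|) :
  skew_span e = 0 <->
  complete_graph e \/
  edgeless_graph e \/
  doubly_extended_bouquet_dipole e \/
  odd_bouquet e \/
  two_set_perfectly_orderable e.
Proof.
split; first exact: skew_span0_families.
case=> [|[|[|[]]]].
- exact: complete_span0.
- exact: edgeless_span0.
- exact: dipole_span0.
- exact: bouquet_span0.
- move=> ord; apply: skew_span0_full => X fX.
  by case/negP: (orderable_no_fort e_sym X ord).
Qed.
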